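(* The condition $K_m>0$ is not necessary for $\Sigma_m$ to be of contact type: there exist a normalised profile function $\gamma$ and $m>0$ such that, for the magnetic system $(S^2_\gamma,g_\gamma,\mu_\gamma)$, the energy level $\Sigma_m$ is of contact type but the magnetic curvature $K_m=m^2K+1$ is not everywhere positive.
   Context: A normalised profile function is a smooth $\gamma:[0,\ell_\gamma]\to\mathbb R$ such that: $\gamma(0)=\gamma(\ell_\gamma)=0$ and $\gamma>0$ on $(0,\ell_\gamma)$; $\dot\gamma(0)=1$, $\dot\gamma(\ell_\gamma)=-1$ and $|\dot\gamma|<1$ on $(0,\ell_\gamma)$; all even derivatives of $\gamma$ vanish at $0$ and $\ell_\gamma$; $\int_0^{\ell_\gamma}\gamma\,dt=2$. $S^2_\gamma$ is the quotient of $[0,\ell_\gamma]\times\mathbb R/2\pi\mathbb Z$ (coordinates $(t,\theta)$) collapsing each boundary circle to a pole, with metric $g_\gamma=dt^2+\gamma^2d\theta^2$, area form $\mu_\gamma=\gamma\,dt\wedge d\theta$ and Gaussian curvature $K=-\ddot\gamma/\gamma$. On $\pi:TS^2_\gamma\to S^2_\gamma$ put $\lambda_{(x,v)}(\xi)=g_\gamma(v,d\pi\,\xi)$, $\omega=d\lambda-\pi^*\mu_\gamma$, $E=\frac12|v|^2$, $\Sigma_m=\{E=m^2/2\}$. $\Sigma_m$ is of contact type if $\omega|_{\Sigma_m}$ has a primitive which is a contact form. *)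

(* Defs.v *)
From HB Require Import structures.
From mathcomp Require Import all_boot all_order all_algebra.
From mathcomp Require Import all_classical all_reals all_analysis.
From mathcomp Require Import ring lra.

Set Implicit Arguments.
Unset Strict Implicit.
Unset Printing Implicit Defensive.

Import Order.TTheory GRing.Theory Num.Theory.
Import numFieldNormedType.Exports.
Local Open Scope classical_set_scope.
Local Open Scope ring_scope.

Section forms.
Variables (R : realType) (V W : normedModType R).

(* In finite dimension, [Ck k U f] says that [f] is of class C^k on the open
   set [U]. *)
Fixpoint Ck (k : nat) (U : set V) (f : V -> W) : Prop :=
  if k is k'.+1 then
    (forall x, U x -> differentiable f x) /\
    (forall v, Ck k' U (fun x => 'D_v f x))
  else forall x, U x -> {for x, continuous f}.

Definition smooth_on (U : set V) (f : V -> W) := forall k, Ck k U f.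

End forms.

Section exterior.
Variables (R : realType) (V : normedModType R).

Definition one_form := V -> V -> R.

Definition smooth_one_form (U : set V) (a : one_form) :=
  (forall x, U x -> scalar (a x)) /\
  (forall v, smooth_on U (fun x => a x v : R^o)).

(* d a (u, v) = u (a v) - v (a u) for the constant vector fields u and v. *)
Definition ext_deriv (a : one_form) (x u v : V) : R :=
  'D_u (fun y => a y v : R^o) x - 'D_v (fun y => a y u : R^o) x.

Definition wedge12 (a : V -> R) (b : V -> V -> R) (u v w : V) : R :=
  a u * b v w + a v * b w u + a w * b u v.

End exterior.

Section profile.
Variable R : realType.

(* Smoothness on the closed interval [0, l] is understood as being the
   restriction of a smooth function on the line; the values of [gamma] outside
   [0, l] are irrelevant, and so is the chosen extension. *)
Definition normalised_profile (l : R) (gamma : R -> R) : Prop :=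
  0 < l /\
  [/\ (forall (n : nat) (t : R), derivable (derive1n n gamma) t 1),
      [/\ gamma 0 = 0, gamma l = 0 & (forall t, 0 < t < l -> 0 < gamma t)],
      [/\ derive1n 1 gamma 0 = 1, derive1n 1 gamma l = -1
        & (forall t, 0 < t < l -> `|derive1n 1 gamma t| < 1)],
      (forall k : nat, derive1n (k.*2) gamma 0 = 0 /\ derive1n (k.*2) gamma l = 0)
    & (\int[lebesgue_measure]_(t in `[0%R, l]) (gamma t)%:E = 2%:E)%E].

(* The curvature at the point (t, theta), which does not depend on theta. At the
   two poles -gamma''/gamma is extended by continuity; gamma and gamma'' vanish
   there, and L'Hopital's rule gives the limit. *)
Definition gauss_curvature (l : R) (gamma : R -> R) (t : R) : R :=
  if (t == 0) || (t == l) then - derive1n 3 gamma t / derive1n 1 gamma t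
  else - derive1n 2 gamma t / gamma t.

Definition magnetic_curvature (l : R) (gamma : R -> R) (m t : R) : R :=
  m ^+ 2 * gauss_curvature l gamma t + 1.

End profile.

Section surface.
Variable R : realType.

Local Notation plane := 'rV[R]_2.

Definition dotp (u w : plane) : R := u 0 0 * w 0 0 + u 0 1 * w 0 1.
Definition cross (u w : plane) : R := u 0 0 * w 0 1 - u 0 1 * w 0 0.
(* The Euclidean norm; the library norm of 'rV_2 is the sup norm. *)
Definition eucl (q : plane) : R := Num.sqrt (dotp q q).

Definition polar (r th : R) : plane :=
  \row_(j < 2) (if j == 0 then r * cos th else r * sin th).

Variables (l : R) (gamma : R -> R).

(* The points (t, theta) of [0, l] x R that become equal in S^2_gamma. *)
Definition same_point (p p' : R * R) : Prop :=
  p.1 = p'.1 /\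
  (p.1 = 0 \/ p.1 = l \/ exists k : int, p.2 - p'.2 = k%:~R * (pi *+ 2)).

(* The chart [chart false] is centred at the pole t = 0 and covers t < l; the
   chart [chart true] is centred at the pole t = l and covers 0 < t. Each one
   has image the open disc of radius l, see [chart_eqP] and [chart_onto]. *)
Definition chart (i : bool) (p : R * R) : plane :=
  polar (if i then l - p.1 else p.1) p.2.

Definition chart_dom (i : bool) (p : R * R) : Prop :=
  if i then 0 < p.1 <= l else 0 <= p.1 < l.

Definition disc : set plane := [set q | eucl q < l].

(* The change of charts, an involution of the punctured disc. *)
Definition trans (q : plane) : plane := ((l - eucl q) / eucl q) *: q.

(* The coordinate t and the coframe dt, dtheta in the chart [i]. *)
Definition height (i : bool) (q : plane) : R :=
  if i then l - eucl q else eucl q.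
Definition dheight (i : bool) (q u : plane) : R :=
  (-1) ^+ i * (dotp q u / eucl q).
Definition dangle (q u : plane) : R := cross q u / dotp q q.

(* dt^2 + gamma^2 dtheta^2 in the chart [i], see [metric_chart], extended by
   continuity to the centre of the chart. *)
Definition metric (i : bool) (q u w : plane) : R :=
  if q == 0 then dotp u w
  else dheight i q u * dheight i q w
       + gamma (height i q) ^+ 2 * (dangle q u * dangle q w).

(* gamma dt /\ dtheta in the chart [i], see [area_chart], extended by
   continuity. The chart [true] reverses the orientation. *)
Definition area (i : bool) (q u w : plane) : R :=
  if q == 0 then (-1) ^+ i * cross u w
  else gamma (height i q)
       * (dheight i q u * dangle q w - dheight i q w * dangle q u).

Local Notation tplane := (plane * plane)%type.

(* A point (q, v) of [tplane] stands, in the chart [i], for the vector v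
   tangent to the surface at the point of coordinates q; the projection pi is
   [fst], and so is its differential. *)
Definition liouville (i : bool) : one_form tplane :=
  fun p xi => metric i p.1 p.2 xi.1.

Definition omega (i : bool) (p xi eta : tplane) : R :=
  ext_deriv (liouville i) p xi eta - area i p.1 xi.1 eta.1.

Definition energy (i : bool) (p : tplane) : R :=
  metric i p.1 p.2 p.2 / 2.

(* The change of charts and its differential. *)
Definition ttrans (p : tplane) : tplane := (trans p.1, 'D_(p.2) trans p.1).

(* The part of Sigma_m lying over the chart [i]. *)
Definition level (m : R) (i : bool) : set tplane :=
  [set p | disc p.1 /\ energy i p = m ^+ 2 / 2].

(* The tangent space of Sigma_m at p, as the kernel of dE: for m > 0 the
   level is regular. *)
Definition level_tangent (i : bool) (p : tplane) : set tplane :=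
  [set xi | 'D_xi (energy i : tplane -> R^o) p = 0].

(* A smooth 1-form on Sigma_m: in each chart the restriction of a smooth form
   defined on a neighbourhood in the tangent bundle, the two restrictions
   being exchanged by the change of charts. *)
Definition smooth_form_on_level (m : R) (a : bool -> one_form tplane) : Prop :=
  (forall i, exists U : set tplane,
     [/\ open U, level m i `<=` U & smooth_one_form U (a i)]) /\
  (forall p xi, level m false p -> p.1 != 0 -> level_tangent false p xi ->
     a false p xi = a true (ttrans p) ('D_xi ttrans p)).

Definition primitive_on_level (m : R) (a : bool -> one_form tplane) : Prop :=
  forall i p xi eta, level m i p ->
    level_tangent i p xi -> level_tangent i p eta ->
    ext_deriv (a i) p xi eta = omega i p xi eta.

(* As Sigma_m is 3-dimensional, a contact form is a form a such that the
   3-form a /\ da vanishes nowhere. *)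
Definition contact_on_level (m : R) (a : bool -> one_form tplane) : Prop :=
  forall i p, level m i p ->
    exists xi eta zeta, [/\ level_tangent i p xi, level_tangent i p eta,
      level_tangent i p zeta
      & wedge12 (a i p) (ext_deriv (a i) p) xi eta zeta != 0].

Definition contact_type (m : R) : Prop :=
  exists a : bool -> one_form tplane,
    [/\ smooth_form_on_level m a, primitive_on_level m a
      & contact_on_level m a].

End surface.

Section chart_theory.
Variables (R : realType) (l : R) (gamma : R -> R).

Lemma polar0 (r th : R) : polar r th 0 0 = r * cos th.
Proof. by rewrite mxE. Qed.

Lemma polar1 (r th : R) : polar r th 0 1 = r * sin th.
Proof. by rewrite mxE. Qed.

Lemma planeP (u w : 'rV[R]_2) : u 0 0 = w 0 0 -> u 0 1 = w 0 1 -> u = w.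
Proof.
move=> h0 h1; apply/rowP => j; case: (unliftP 0 j) => [k ->|-> //].
by rewrite (_ : lift 0 k = 1) //; apply/val_inj; rewrite /= (ord1 k).
Qed.

Lemma eucl_polar (r th : R) : 0 <= r -> eucl (polar r th) = r.
Proof.
move=> r0; rewrite /eucl /dotp polar0 polar1.
rewrite (_ : _ + _ = r ^+ 2 * (cos th ^+ 2 + sin th ^+ 2)); last by ring.
by rewrite cos2Dsin2 mulr1 sqrtr_sqr ger0_norm.
Qed.

Lemma periodicz (f : R -> R) (T x : R) (k : int) :
  periodic f T -> f (x + k%:~R * T) = f x.
Proof.
move=> hf; case: k => n.
  by rewrite -[_%:~R]/(n%:R) mulr_natl periodicn.
rewrite NegzE mulrNz mulNr -[_%:~R]/(n.+1%:R) mulr_natl.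
by rewrite -[LHS](periodicn hf n.+1) subrK.
Qed.

Lemma cos_eq1 (x : R) : cos x = 1 -> exists k : int, x = k%:~R * (pi *+ 2).
Proof.
move=> cx; have p0 := pi_gt0 R.
have q0 : 0 < pi *+ 2 :> R by rewrite mulr2n; lra.
set k := Num.floor (x / (pi *+ 2)); exists k.
have : cos (x - k%:~R * (pi *+ 2)) = 1.
  by rewrite -mulNr -mulrNz periodicz //; exact: cosD2pi.
have /andP[] := floor_itv (x / (pi *+ 2)).
rewrite -/k ler_pdivlMr // ltr_pdivrMr // intrD mulrDl mul1r.
set y := x - _ => h1 h2 cy.
have y0 : 0 <= y by rewrite /y; lra.
have y1 : y < pi *+ 2 by rewrite /y; lra.
suff : y = 0 by rewrite /y; lra.
apply/eqP; case: ltgtP y0 => // ypos _.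
have s0 : 0 < sin (y / 2) by apply: sin_gt0_pi; rewrite mulr2n in y1; lra.
have : cos y = 1 - sin (y / 2) ^+ 2 *+ 2.
  rewrite [in LHS](splitr y) cosD -!expr2 (cos2sin2 (y / 2)) mulr2n; ring.
rewrite cy mulr2n; have : 0 < sin (y / 2) ^+ 2 by rewrite exprn_gt0.
by lra.
Qed.

Lemma chart_eqP (i : bool) (p p' : R * R) :
  0 < l -> chart_dom l i p -> chart_dom l i p' ->
  chart l i p = chart l i p' <-> same_point l p p'.
Proof.
move=> l0 dp dp'; pose r (p : R * R) := if i then l - p.1 else p.1.
have rE q : chart l i q = polar (r q) q.2 by [].
have r0 q : chart_dom l i q -> 0 <= r q.
  by rewrite /chart_dom /r; case: (i) => /andP[]; lra.
have r_inj q q' : r q = r q' -> q.1 = q'.1 by rewrite /r; case: (i); lra.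
split=> [|[e1 e2]]; last first.
  have er : r p = r p' by rewrite /r e1.
  have [z|nz] := eqVneq (r p) 0.
    by apply: planeP; rewrite !rE ?polar0 ?polar1 -er z !mul0r.
  case: e2 => [e|[e|[k e]]].
  - move: dp nz; rewrite /chart_dom /r; case: (i); rewrite e ?ltxx ?eqxx //.
  - move: dp nz; rewrite /chart_dom /r; case: (i); rewrite e ?ltxx ?subrr ?eqxx ?andbF //.
  have -> : p = (p.1, p'.2 + k%:~R * (pi *+ 2)).
    by case: (p) (p') e => [a b] [c d] /= e; congr pair; lra.
  apply: planeP; rewrite !rE ?polar0 ?polar1 /=.
    rewrite periodicz ?er //; last exact: cosD2pi.
    by rewrite -er /r /=.
  rewrite periodicz ?er //; last exact: sinD2pi.
  by rewrite -er /r /=.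
move=> e; have er : r p = r p'.
  by rewrite -(eucl_polar p.2 (r0 _ dp)) -(eucl_polar p'.2 (r0 _ dp')) -!rE e.
split; first exact: r_inj.
have [z|nz] := eqVneq (r p) 0.
  by move: z; rewrite /r; case: (i) => z; [right; left|left]; lra.
right; right; apply: cos_eq1.
move: e; rewrite !rE -er => e.
have := congr1 (fun q : 'rV[R]_2 => q 0 0) e; rewrite !polar0 => /(mulfI nz) c.
have := congr1 (fun q : 'rV[R]_2 => q 0 1) e; rewrite !polar1 => /(mulfI nz) s.
by rewrite cosB c s -!expr2 cos2Dsin2.
Qed.

Lemma chart_onto (i : bool) (q : 'rV[R]_2) : 0 < l ->
  disc l q <-> exists2 p, chart_dom l i p & chart l i p = q.
Proof.
move=> l0; rewrite /disc /=; split; last first.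
  case=> p dp <-; rewrite /chart eucl_polar; move: dp; rewrite /chart_dom;
    by case: (i) => /andP[]; lra.
move=> rq; have r0 : 0 <= eucl q by exact: sqrtr_ge0.
suff [th e] : exists th, polar (eucl q) th = q.
  exists (if i then l - eucl q else eucl q, th).
    by rewrite /chart_dom; case: (i) => /=; lra.
  by rewrite /chart -e /=; case: (i) => //=; congr polar; rewrite e; lra.
have d0 : 0 <= dotp q q by rewrite /dotp -!expr2 addr_ge0 ?sqr_ge0.
have r2 : eucl q ^+ 2 = q 0 0 ^+ 2 + q 0 1 ^+ 2 by rewrite sqr_sqrtr.
have [z|nz] := eqVneq (eucl q) 0.
  exists 0; move: r2; rewrite z expr0n /= => /esym/eqP.
  rewrite paddr_eq0 ?sqr_ge0 // !sqrf_eq0 => /andP[/eqP a /eqP b].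
  by apply: planeP; rewrite ?polar0 ?polar1 mul0r.
pose c := q 0 0 / eucl q; pose s := q 0 1 / eucl q.
have cs : c ^+ 2 + s ^+ 2 = 1.
  by rewrite /c /s !expr_div_n -mulrDl -r2 divff // expf_neq0.
have c1 : -1 <= c <= 1.
  have : 0 <= s ^+ 2 := sqr_ge0 _; move: cs; nra.
have ss : sin (acos c) = `|s|.
  by rewrite sin_acos // -sqrtr_sqr; congr Num.sqrt; lra.
exists (if 0 <= s then acos c else - acos c).
have Hc : eucl q * c = q 0 0 by rewrite /c mulrC divfK.
have Hs : eucl q * s = q 0 1 by rewrite /s mulrC divfK.
apply: planeP; rewrite ?polar0 ?polar1.
  by case: ifP => _; rewrite ?cosN acosK.
case: ifP => hs; rewrite ?sinN ss; first by rewrite ger0_norm.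
by rewrite ltr0_norm ?opprK // ltNge hs.
Qed.

Lemma chart_trans (p : R * R) : 0 < p.1 < l ->
  trans l (chart l false p) = chart l true p.
Proof.
move=> /andP[p0 p1]; rewrite /trans /chart eucl_polar; last by lra.
apply: planeP; rewrite mxE ?polar0 ?polar1 mulrA divfK //; lra.
Qed.

(* The vector which the chart [i] assigns to a d/dt + b d/dtheta. *)
Definition dchart (i : bool) (p v : R * R) : 'rV[R]_2 :=
  'D_(v : R^o * R^o) (chart l i : R^o * R^o -> 'rV[R]_2) p.


Lemma is_derive_line (f : R^o * R^o -> R^o) (p v : R * R) (d : R) :
  is_derive (0 : R) (1 : R) (fun h => f (h * v.1 + p.1, h * v.2 + p.2)) d ->
  is_derive (p : R^o * R^o) (v : R^o * R^o) f d.
Proof.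
move=> [df ed].
have E : (fun h : R => f (h *: (v : R^o * R^o) + p)) =
    (fun h => f (h * v.1 + p.1, h * v.2 + p.2)).
  by apply/funext => h; congr f; case: (p) (v) => [? ?] [].
split; first by apply/derivable1P; rewrite E.
rewrite -ed -E /derive.
set F := (X in X @ _); set G := (X in _ = lim (X @ _)).
suff -> : F = G by [].
apply/funext => h; rewrite /F /G /=.
by rewrite scale0r add0r addr0 /GRing.scale /= mulr1.
Qed.

Lemma dchartE (i : bool) (p v : R * R) (r := if i then l - p.1 else p.1) :
  dchart i p v = \row_(j < 2) (if j == 0
    then (-1) ^+ i * v.1 * cos p.2 - r * v.2 * sin p.2
    else (-1) ^+ i * v.1 * sin p.2 + r * v.2 * cos p.2).
Proof.
have D (f : R -> R) (df : R) : is_derive p.2 (1 : R) f df ->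
  is_derive (p : R^o * R^o) (v : R^o * R^o)
   (fun p : R^o * R^o => (if i then l - p.1 else p.1) * f p.2 : R^o)
   ((-1) ^+ i * v.1 * f p.2 + r * v.2 * df).
  move=> hf; apply: is_derive_line => /=.
  have L (a b x : R) : is_derive x (1 : R) (fun h => h * a + b) a.
    by apply: is_derive_eq; rewrite !scaler0 !addr0 add0r /GRing.scale /= mulr1.
  have hf' : is_derive (0 * v.2 + p.2) (1 : R) f df by rewrite mul0r add0r.
  have K : is_derive (0 : R) (1 : R) (fun h => f (h * v.2 + p.2)) (v.2 * df).
    have := @is_derive1_comp R f (fun h => h * v.2 + p.2) 0 df v.2 hf' (L _ _ _).
    by rewrite mulrC.
  have M : is_derive (0 : R) (1 : R)
     (fun h => if i then l - (h * v.1 + p.1) else h * v.1 + p.1)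
     ((-1) ^+ i * v.1).
    case: (i); last by rewrite expr0 mul1r; exact: L.
    rewrite expr1 mulN1r (_ : (fun h => _) = (fun h => h * (- v.1) + (l - p.1))).
      exact: L.
    by apply/funext => h; ring.
  have := is_deriveM M K.
  rewrite /r !mul0r !add0r; set d1 := (X in is_derive _ _ _ X -> _).
  set d2 := (X in _ -> is_derive _ _ _ X).
  suff -> : d1 = d2 by [].
  by rewrite /d1 /d2 /GRing.scale /=; ring.

have Dc := D cos (- sin p.2) (is_derive_cos p.2).
have Ds := D sin (cos p.2) (is_derive_sin p.2).
have dv : derivable (chart l i : R^o * R^o -> 'rV[R]_2) p v.
  apply/derivable_mxP => a b; rewrite (_ : (fun _ => _) = (fun q : R^o * R^o =>
    (if i then l - q.1 else q.1) * (if b == 0 then cos q.2 else sin q.2))).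
    by case: (b == 0); [case: Dc|case: Ds].
  by apply/funext => q; rewrite /chart mxE; case: (b == 0).
rewrite /dchart derive_mx //; apply/rowP => b; rewrite !mxE.
rewrite (_ : (fun _ => _) = (fun q : R^o * R^o =>
    (if i then l - q.1 else q.1) * (if b == 0 then cos q.2 else sin q.2))).
  by case: (b == 0); [case: Dc => _ ->|case: Ds => _ ->]; rewrite ?mulrN ?mulrA.
by apply/funext => q; rewrite /chart mxE; case: (b == 0).
Qed.

Lemma dchart_dotp i t th a b : 0 < t < l ->
  dotp (chart l i (t, th)) (dchart i (t, th) (a, b)) =
  eucl (chart l i (t, th)) * ((-1) ^+ i * a).
Proof.
move=> /andP[t0 tl]; rewrite dchartE /chart eucl_polar; last by case: (i) => /=; lra.
rewrite /dotp polar0 polar1 !mxE /=; set r := if i then _ else _.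
rewrite -[RHS]mulr1 -(cos2Dsin2 th); ring.
Qed.

Lemma dchart_cross i t th a b : 0 < t < l ->
  cross (chart l i (t, th)) (dchart i (t, th) (a, b)) =
  eucl (chart l i (t, th)) ^+ 2 * b.
Proof.
move=> /andP[t0 tl]; rewrite dchartE /chart eucl_polar; last by case: (i) => /=; lra.
rewrite /cross polar0 polar1 !mxE /=; set r := if i then _ else _.
rewrite -[RHS]mulr1 -(cos2Dsin2 th); ring.
Qed.

Lemma dotpp (q : 'rV[R]_2) : dotp q q = eucl q ^+ 2.
Proof. by rewrite sqr_sqrtr // /dotp -!expr2 addr_ge0 ?sqr_ge0. Qed.

Lemma coframe_chart i t th a b : 0 < t < l ->
  [/\ chart l i (t, th) != 0, height l i (chart l i (t, th)) = t,
      dheight i (chart l i (t, th)) (dchart i (t, th) (a, b)) = a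
    & dangle (chart l i (t, th)) (dchart i (t, th) (a, b)) = b].
Proof.
move=> tl; have r0 : 0 < eucl (chart l i (t, th)).
  by rewrite /chart eucl_polar; move: tl; case: (i) => /= /andP[]; lra.
split.
- apply/eqP => e; move: r0; rewrite e /eucl /dotp !mxE !mul0r addr0 sqrtr0.
  by rewrite ltxx.
- rewrite /height /chart eucl_polar; move: tl; case: (i) => /= /andP[]; lra.
- rewrite /dheight dchart_dotp // mulrAC divff ?gt_eqF // mul1r mulrA.
  by rewrite -expr2 sqrr_sign mul1r.
- by rewrite /dangle dchart_cross // dotpp mulrAC divff ?mul1r // expf_neq0 ?gt_eqF.
Qed.

Lemma metric_chart i t th a b c d : 0 < t < l ->
  metric l gamma i (chart l i (t, th))
    (dchart i (t, th) (a, b)) (dchart i (t, th) (c, d))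
  = a * c + gamma t ^+ 2 * (b * d).
Proof.
move=> tl; have [/negbTE n e1 e2 e3] := coframe_chart i th a b tl.
by have [_ _ f2 f3] := coframe_chart i th c d tl; rewrite /metric n e1 e2 e3 f2 f3.
Qed.

Lemma area_chart i t th a b c d : 0 < t < l ->
  area l gamma i (chart l i (t, th))
    (dchart i (t, th) (a, b)) (dchart i (t, th) (c, d))
  = gamma t * (a * d - c * b).
Proof.
move=> tl; have [/negbTE n e1 e2 e3] := coframe_chart i th a b tl.
by have [_ _ f2 f3] := coframe_chart i th c d tl; rewrite /area n e1 e2 e3 f2 f3.
Qed.


End chart_theory.

(* Main.v *)
From HB Require Import structures.
Require Import Defs.
From mathcomp Require Import all_boot all_order all_algebra.
From mathcomp Require Import all_classical all_reals all_analysis.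
From mathcomp Require Import ring lra.
Import Order.TTheory GRing.Theory Num.Theory.
Import numFieldNormedType.Exports.

(* The profile is gamma(t) = sin x (3/2 - 5/4 sin^2 x) with x = 2t/3 and
   l = 3 pi/2. At the equator K = -4, so that K_1 = -3 there.

   Write r = |q| for the Euclidean radius in a polar chart and s = r^2. Then
   gamma(r) = r (1 + s H(s)) with H entire, the matrix
   A_q u = u + H(s) (q x u) Jq is a smooth square root of the metric, and
   w = A_q v has Euclidean norm |v|_g and argument theta + phi, where phi is the
   angle of v in the frame d/dt, d/dtheta. Let Gamma be the primitive of gamma
   that vanishes at the centre of the chart. On the level |w| = 1,
     a = lambda - Gamma dtheta + w x dw
   is a primitive of omega, as w x dw = |w|^2 d(theta + phi) is closed there.
   The connection form psi = dphi + gamma' dtheta is hidden in it: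
   a = lambda - beta + psi with beta = (Gamma + gamma' - 1) dtheta,
   dbeta = (1 - K) mu. On the magnetic geodesic field a is 2 - beta(v), and
     beta = - 15/8 cos x sin^2 x dtheta
   has norm less than 2. In the other chart the orientation, hence the sign of
   the last two terms of a, is reversed; the change of charts acts on w by a
   reflection, and Gamma(r) + Gamma(l - r) = 2 makes the two forms agree. *)

Set Implicit Arguments.
Unset Strict Implicit.
Unset Printing Implicit Defensive.
Local Open Scope classical_set_scope.
Local Open Scope ring_scope.

(* Expressions with a symbolic derivative: the functions that occur below are
   values of expressions, so that smoothness holds by construction and
   directional derivatives are computed. In [App f n], the family [f] is meant
   to be the sequence of the successive derivatives of a function. *)
Inductive expr (R : Type) :=
| Cst of R | Var of nat | Add of expr R & expr R | Mul of expr R & expr R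
| App of (nat -> R -> R) & nat & expr R | Rsqrt of expr R.
Arguments Var {R}.

(** * Symbolic differentiation: domain, symmetry and linearity *)

Section expr.
Variable R : realType.
Implicit Types (e : expr R) (x y z : nat -> R).

Fixpoint eval x e : R :=
  match e with
  | Cst c => c
  | Var i => x i
  | Add e1 e2 => eval x e1 + eval x e2
  | Mul e1 e2 => eval x e1 * eval x e2
  | App f n e1 => f n (eval x e1)
  | Rsqrt e1 => (Num.sqrt (eval x e1))^-1
  end.

(** The direction is a vector with coordinates [y], so a variable has a constant derivative. For
    [Rsqrt] the power -3/2 is written as a cube, which stays inside the language. *)
Fixpoint symderiv y e : expr R :=
  match e with
  | Cst _ => Cst 0
  | Var i => Cst (y i)
  | Add e1 e2 => Add (symderiv y e1) (symderiv y e2)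
  | Mul e1 e2 => Add (Mul (symderiv y e1) e2) (Mul e1 (symderiv y e2))
  | App f n e1 => Mul (App f n.+1 e1) (symderiv y e1)
  | Rsqrt e1 =>
      let r := Rsqrt e1 in
      Mul (Mul (Cst (- 2^-1)) (Mul r (Mul r r))) (symderiv y e1)
  end.

Definition derivatives (f : nat -> R -> R) :=
  forall n (t : R), is_derive t (1 : R) (f n) (f n.+1 t).

Fixpoint defined x e : Prop :=
  match e with
  | Cst _ | Var _ => True
  | Add e1 e2 | Mul e1 e2 => defined x e1 /\ defined x e2
  | App f _ e1 => derivatives f /\ defined x e1
  | Rsqrt e1 => 0 < eval x e1 /\ defined x e1
  end.

Lemma defined_symderiv x y e : defined x e -> defined x (symderiv y e).
Proof.
by elim: e => //= [e1 h1 e2 h2|e1 h1 e2 h2|f n e1 h1|e1 h1] []; tauto.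
Qed.

(** Symmetry of second derivatives, by which the second-order terms cancel in the exterior
    derivative of w x dw. *)
Lemma symderivC x y z e :
  eval x (symderiv y (symderiv z e)) = eval x (symderiv z (symderiv y e)).
Proof.
elim: e => //= [e1 -> e2 ->|e1 h1 e2 h2|f n e1 h1|e1 h1] //;
  rewrite ?h1 ?h2; ring.
Qed.

Lemma symderiv_linear x e k y z : eval x (symderiv (fun i => k * y i + z i) e) =
  k * eval x (symderiv y e) + eval x (symderiv z e).
Proof.
elim: e => //= [c|e1 h1 e2 h2|e1 h1 e2 h2|f n e1 h1|e1 h1];
  rewrite ?h1 ?h2; ring.
Qed.

End expr.

(** * Symbolic derivatives as directional derivatives on a normed space *)

Section calculus.
Variables (R : realType) (V : normedModType R) (X : nat -> V -> R).
(** Each coordinate is its own differential, that is, continuous and linear. *)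
Hypothesis X_diff : forall i p, is_diff p (X i : V -> R^o) (X i : V -> R^o).
Implicit Types (e : expr R).

Definition func e : V -> R^o := fun p => eval (X^~ p) e.

Lemma derive_compR (h : R -> R) (dh : R) (g : V -> R^o) p v :
  differentiable g p -> is_derive (g p : R) (1 : R) h dh ->
  differentiable (h \o g : V -> R^o) p /\
  'D_v (h \o g : V -> R^o) p = dh * 'D_v g p.
Proof.
move=> dg [dh1 dh2].
have dh' : differentiable h (g p) by apply/derivable1_diffP.
have dc : differentiable (h \o g : V -> R^o) p by exact: differentiable_comp.
split=> //; rewrite deriveE // diff_comp //= deriv1E // deriveE //.
by rewrite derive1E dh2 mulrC.
Qed.

Lemma is_derive_rsqrt (t : R) : 0 < t ->
  is_derive t (1 : R) (fun s : R => (Num.sqrt s)^-1)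
    (- 2^-1 * ((Num.sqrt t)^-1 * ((Num.sqrt t)^-1 * (Num.sqrt t)^-1))).
Proof.
move=> t0; have h := is_derive1_sqrt t0.
have n0 : Num.sqrt t != 0 by rewrite gt_eqF // sqrtr_gt0.
have := @is_deriveV R Num.sqrt t _ 1 n0 h.
set d := (X in is_derive _ _ _ X -> _); set d' := (X in _ -> is_derive _ _ _ X).
suff -> : d = d' by [].
by rewrite /d /d' /GRing.scale /=; field.
Qed.

Lemma func_diff e p v : defined (X^~ p) e ->
  differentiable (func e) p /\ 'D_v (func e) p = func (symderiv (X^~ v) e) p.
Proof.
rewrite /func; elim: e => [c|i|e1 h1 e2 h2|e1 h1 e2 h2|f n e1 h1|e1 h1] /=.
- by move=> _; split; [exact: differentiable_cst|exact: derive_cst].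
- move=> _; have d : differentiable (X i : V -> R^o) p by [].
  by split=> //; rewrite deriveE // diff_val.
- move=> [/h1[d1 e1'] /h2[d2 e2']]; split; first exact: differentiableD.
  by rewrite deriveD ?e1' ?e2' //; exact: diff_derivable.
- move=> [/h1[d1 e1'] /h2[d2 e2']]; split; first exact: differentiableM.
  rewrite deriveM ?e1' ?e2' //; try exact: diff_derivable.
  by rewrite /GRing.scale /=; ring.
- move=> [hf /h1[d1 <-]].
  exact: (derive_compR v d1 (hf n _)).
- move=> [pos /h1[d1 <-]].
  exact: (derive_compR v d1 (is_derive_rsqrt pos)).
Qed.

Lemma differentiable_func e p : defined (X^~ p) e -> differentiable (func e) p.
Proof. by move=> /(@func_diff e p 0)[]. Qed.

Lemma derive_func e p v : defined (X^~ p) e ->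
  'D_v (func e) p = func (symderiv (X^~ v) e) p.
Proof. by move=> /(@func_diff e p v)[]. Qed.

(** The derivative of an expression is again an everywhere defined expression, so induction on the
    order applies. *)
Lemma smooth_func e : (forall p, defined (X^~ p) e) -> smooth_on setT (func e).
Proof.
move=> de k; elim: k e de => [|k IH] e de /=.
  by move=> p _; apply: differentiable_continuous; exact: differentiable_func.
split=> [p _|v]; first exact: differentiable_func.
rewrite (_ : (fun _ => _) = func (symderiv (X^~ v) e)).
  by apply: IH => p; exact: defined_symderiv.
by apply/funext => p; exact: derive_func.
Qed.

End calculus.


(** * Successive derivatives of an expression in one real variable *)

Section realline.
Variable R : realType.

Definition evalR (e : expr R) : R -> R := fun t => eval (fun=> t) e.
Definition derivs (e : expr R) (n : nat) : R -> R :=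
  evalR (iter n (symderiv (fun=> 1)) e).

Lemma derivativesP (e : expr R) : (forall t, defined (fun=> t) e) ->
  derivatives (derivs e).
Proof.
move=> de n t.
have dn : defined (fun=> t) (iter n (symderiv (fun=> 1)) e).
  by elim: n => //= n IH; exact: defined_symderiv.
have XD i (p : R) : is_diff p ((fun (_ : nat) (t : R) => t) i : R -> R^o) id.
  exact: is_diff_id.
have [d E] := func_diff XD 1 dn.
by apply: DeriveDef; [exact: diff_derivable|exact: E].
Qed.

End realline.

(** * Power series with factorial decay and the sine series *)

Section sinc.
Variable R : realType.

(** This bound is stable under termwise differentiation, as (k+1) / (k+1)! = 1 / k!, and gives
    convergence everywhere by comparison with the exponential series. *)
Definition inv_fact_bounded (c : nat -> R) := forall k, `|c k| <= k`!%:R^-1.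

Lemma inv_fact_bounded_diffs (c : nat -> R) :
  inv_fact_bounded c -> inv_fact_bounded (pseries_diffs c).
Proof.
move=> hc k; rewrite /pseries_diffs normrM ger0_norm //.
have := hc k.+1; rewrite factS natrM invfM => h.
by rewrite mulrC -ler_pdivlMr ?ltr0Sn // mulrC.
Qed.

Lemma is_cvg_inv_fact_bounded (c : nat -> R) (x : R) :
  inv_fact_bounded c -> cvgn (pseries c x).
Proof.
move=> hc; apply: normed_cvg.
apply: (series_le_cvg (v_ := exp_coeff `|x|)) => //= [n|n|].
- by rewrite /exp_coeff /= divr_ge0 // exprn_ge0.
- by rewrite /exp_coeff /= normrM normrX mulrC ler_wpM2l ?exprn_ge0.
- exact: is_cvg_series_exp_coeff.
Qed.

Definition psum (c : nat -> R) (n : nat) : R -> R :=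
  fun x => limn (pseries (iter n (@pseries_diffs R) c) x).

Lemma derivatives_psum (c : nat -> R) :
  inv_fact_bounded c -> derivatives (psum c).
Proof.
move=> hc n t.
have hn : forall n, inv_fact_bounded (iter n (@pseries_diffs R) c).
  by elim=> // m; exact: inv_fact_bounded_diffs.
apply: (@pseries_snd_diffs R _ (`|t| + 1)).
- exact: is_cvg_inv_fact_bounded.
- by apply: is_cvg_inv_fact_bounded; exact: (hn n.+1).
- by apply: is_cvg_inv_fact_bounded; exact: (hn n.+2).
- by apply: lt_le_trans (ler_norm _); rewrite ltrDl.
Qed.

Definition tcoef (k : nat) : R := (-1) ^+ k.+1 / (k.*2.+3)`!%:R.
(* The sequence of derivatives of the entire function T such that
   sin x = x (1 + x^2 T(x^2)). *)
Definition Ts := psum tcoef.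

Lemma tcoef_bounded : inv_fact_bounded tcoef.
Proof.
move=> k.
rewrite /tcoef normrM normrX normrN1 expr1n mul1r ger0_norm ?invr_ge0 //.
rewrite lef_pV2 ?posrE ?ltr0n ?fact_gt0 // ler_nat; apply: leq_fact.
by rewrite -addnn -addnS -addnS -addnS leq_addr.
Qed.

Lemma derivatives_Ts : derivatives Ts.
Proof. exact: derivatives_psum tcoef_bounded. Qed.

Lemma Ts0 : Ts 0 0 = - 6^-1.
Proof.
rewrite /Ts /psum /=; apply: lim_near_cst => //; near=> n.
rewrite /pseries /series /=.
have n0 : (0 < n)%N by near: n; exact: nbhs_infty_gt.
rewrite -(prednK n0) big_nat_recl // big1 => [|i _]; last first.
  by rewrite exprS mul0r mulr0.
by rewrite /tcoef expr0 addr0 mulr1 expr1 mulN1r.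
Unshelve. all: by end_near. Qed.

Lemma sin_Ts (x : R) : sin x = x * (1 + x ^+ 2 * Ts 0 (x ^+ 2)).
Proof.
have c1 := @cvg_sin_coeff' R x.
have hT : pseries tcoef (x ^+ 2) n @[n --> \oo] --> Ts 0 (x ^+ 2).
  exact: is_cvg_inv_fact_bounded tcoef_bounded.
have c2 : (x + x ^+ 3 * pseries tcoef (x ^+ 2) n) @[n --> \oo] -->
    x + x ^+ 3 * Ts 0 (x ^+ 2).
  by apply: cvgD; [exact: cvg_cst|apply: cvgMl_tmp].
transitivity (x + x ^+ 3 * Ts 0 (x ^+ 2)); last by ring.
(* The leading term x of the sine series is split off, whence the shift by one; the rest is x^3
   times the series in x^2. *)
suff E : (fun n => series (sin_coeff' x) n.+1) =
    (fun n => x + x ^+ 3 * pseries tcoef (x ^+ 2) n).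
  move: c1; rewrite -cvg_shiftS E => c1.
  exact: (cvg_unique (@Rhausdorff R) c1 c2).
apply/funext => n; rewrite /series /= big_nat_recl //; congr (_ + _).
  by rewrite /sin_coeff' expr0z mul1r divr1.
rewrite mulr_sumr; apply: eq_bigr => i _.
rewrite /sin_coeff' /tcoef -exprnP /= -exprM doubleS mul2n !exprS; field.
by rewrite pnatr_eq0 -lt0n fact_gt0.
Qed.

End sinc.

(** * The profile and its primitive as functions of r^2 *)

Section sinc_identities.
Variable R : realType.
Implicit Types x t r : R.

(** One has sin x = x [Sy](x^2) and cos x = [Cy](x^2); the formula for [Cy] comes from
    differentiating x (1 + x^2 T(x^2)). *)
Definition Sy t : R := 1 + t * Ts 0 t.
Definition Cy t : R := 1 + 3 * t * Ts 0 t + 2 * t ^+ 2 * Ts 1 t.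

Lemma cos_Ts x : cos x = Cy (x ^+ 2).
Proof.
pose y : expr R := Mul (Var 0) (Var 0).
pose e := Mul (Var 0) (Add (Cst 1) (Mul y (App (@Ts R) 0 y))).
have ok t : defined (fun=> t) e.
  by rewrite /e /y /=; have := @derivatives_Ts R; tauto.
have [_] := derivativesP ok 0 x.
rewrite (_ : derivs e 0 = sin); last first.
  by apply/funext => t; rewrite sin_Ts expr2.
have [_ ->] := is_derive_sin x; move=> ->.
by rewrite /derivs /evalR /= /Cy -!expr2; ring.
Qed.

(** The left side is the derivative of [Cy] at x^2: differentiate cos x = [Cy](x^2) and divide by
    2x. At x = 0 the value T(0) = -1/6 is used instead. *)
Lemma Cy_derivative x :
  3 * Ts 0 (x ^+ 2) + 7 * x ^+ 2 * Ts 1 (x ^+ 2)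
    + 2 * x ^+ 4 * Ts 2 (x ^+ 2) = - 2^-1 * Sy (x ^+ 2).
Proof.
have [->|x0] := eqVneq x 0.
  by rewrite /Sy !expr0n /= !(mulr0, mul0r) !addr0 Ts0; field.
pose y : expr R := Mul (Var 0) (Var 0).
pose e := Add (Cst 1) (Add (Mul (Cst 3) (Mul y (App (@Ts R) 0 y)))
  (Mul (Cst 2) (Mul (Mul y y) (App (@Ts R) 1 y)))).
have ok t : defined (fun=> t) e.
  by rewrite /e /y /=; have := @derivatives_Ts R; tauto.
have [_] := derivativesP ok 0 x.
rewrite (_ : derivs e 0 = cos); last first.
  apply/funext => t; rewrite cos_Ts /Cy /derivs /evalR /= -!expr2.
  by rewrite !mulrA !addrA.
have [_ ->] := is_derive_cos x; rewrite sin_Ts /Sy => h.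
apply: (mulfI x0); apply: (mulfI (_ : 2 != 0 :> R)); first by [].
transitivity (- (x * (1 + x ^+ 2 * Ts 0 (x ^+ 2)))); last by field.
by rewrite h /derivs /evalR /= -!expr2; ring.
Qed.

Definition gamma0 t : R :=
  sin (2 / 3 * t) * (3 / 2 - 5 / 4 * sin (2 / 3 * t) ^+ 2).

(* With s = r^2, these are functions of s: y = (2r/3)^2,
   S = sin (2r/3) / (2r/3), C = cos (2r/3), D = (1 - C) / y; H and B are
   determined by gamma0 r = r (1 + s H) and s B = \int_0^r gamma0. *)
Definition yE : expr R := Mul (Cst (4 / 9)) (Var 0).
Definition tE n : expr R := App (@Ts R) n yE.
Definition sE : expr R := Add (Cst 1) (Mul yE (tE 0)).
Definition cE : expr R := Add (Cst 1)
  (Add (Mul (Cst 3) (Mul yE (tE 0))) (Mul (Cst 2) (Mul (Mul yE yE) (tE 1)))).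
Definition dE : expr R :=
  Add (Mul (Cst (- 3)) (tE 0)) (Mul (Cst (- 2)) (Mul yE (tE 1))).
Definition HE : expr R := Mul (Cst (4 / 9))
  (Add (tE 0) (Mul (Cst (- (5 / 6))) (Mul sE (Mul sE sE)))).
Definition BE : expr R := Mul (Cst (4 / 9))
  (Mul dE (Add (Cst 1) (Mul (Cst (5 / 8)) (Add cE (Mul cE cE))))).
Definition Hf := derivs HE.
Definition Bf := derivs BE.

Lemma derivatives_Hf : derivatives Hf.
Proof. by apply: derivativesP => t /=; have := @derivatives_Ts R; tauto. Qed.

Lemma derivatives_Bf : derivatives Bf.
Proof. by apply: derivativesP => t /=; have := @derivatives_Ts R; tauto. Qed.

Section at_r.
Variable r : R.
Let y := 4 / 9 * r ^+ 2.
Let S := Sy y.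
Let C := Cy y.

Let yE : y = (2 / 3 * r) ^+ 2. Proof. by rewrite /y; field. Qed.
Let sinE : sin (2 / 3 * r) = 2 / 3 * r * S.
Proof. by rewrite sin_Ts -yE. Qed.
Let cosE : cos (2 / 3 * r) = C.
Proof. by rewrite cos_Ts -yE. Qed.
Let CS : C ^+ 2 = 1 - y * S ^+ 2.
Proof. by rewrite -cosE cos2sin2 sinE yE exprMn. Qed.

Lemma gamma0E : gamma0 r = r * (1 + r ^+ 2 * Hf 0 (r ^+ 2)).
Proof.
rewrite /gamma0 sinE /Hf /derivs /evalR /= -/y /S /Sy.
rewrite (_ : r ^+ 2 = 9 / 4 * y); last by rewrite /y; field.
set T := Ts 0 y.
transitivity (r * (2 / 3 * (1 + y * T) *
    (3 / 2 - 5 / 4 * (4 / 9 * r ^+ 2) * (1 + y * T) ^+ 2))).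
  by field.
by rewrite -/y; field.
Qed.

(** In s = r^2 the identity Gamma' = gamma becomes (s B)' = gamma / (2r), because ds = 2r dr. *)
Lemma Bf_ode : Bf 0 (r ^+ 2) + r ^+ 2 * Bf 1 (r ^+ 2)
  = (1 + r ^+ 2 * Hf 0 (r ^+ 2)) / 2.
Proof.
have := Cy_derivative (2 / 3 * r); rewrite -yE -/S.
rewrite (_ : (2 / 3 * r) ^+ 4 = y ^+ 2); last by rewrite yE -exprM.
move=> ode.
(* Chain rule for s B = 1 - 3/8 C - 5/8 C^3: 4/9 is dy/ds, -S/2 is dC/dy, and the last factor is the
   derivative of 3/8 C + 5/8 C^3 in C. *)
transitivity (- (4 / 9) * (- 2^-1 * S) * (3 / 8 + 15 / 8 * C ^+ 2)).
  rewrite -ode /Bf /derivs /evalR /= -/y /C /Cy.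
  rewrite (_ : r ^+ 2 = 9 / 4 * y); last by rewrite /y; field.
  by field.
rewrite CS /Hf /derivs /evalR /= -/y.
rewrite (_ : r ^+ 2 = 9 / 4 * y); last by rewrite /y; field.
by rewrite /S /Sy; field.
Qed.

(** Here s B is Gamma: it vanishes at r = 0 and equals 2 at r = [ell]. *)
Lemma Bf_primitive : r ^+ 2 * Bf 0 (r ^+ 2) =
  1 - 3 / 8 * cos (2 / 3 * r) - 5 / 8 * cos (2 / 3 * r) ^+ 3.
Proof.
rewrite cosE /Bf /derivs /evalR /= -/y /C /Cy.
rewrite (_ : r ^+ 2 = 9 / 4 * y); last by rewrite /y; field.
by field.
Qed.

(** Since gamma' = 1 + 3 s H + 2 s^2 H', the left side is Gamma + gamma' - 1, the coefficient of
    beta. *)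
Lemma beta_coef : r ^+ 2 *
    (3 * Hf 0 (r ^+ 2) + 2 * r ^+ 2 * Hf 1 (r ^+ 2) + Bf 0 (r ^+ 2)) =
  - (15 / 8) * cos (2 / 3 * r) * sin (2 / 3 * r) ^+ 2.
Proof.
have E : r ^+ 2 = 9 / 4 * y by rewrite /y; field.
rewrite mulrDr Bf_primitive sin2cos2 cosE.
transitivity (- (1 - C) - 5 / 2 * C * (y * S ^+ 2)
    + (1 - 3 / 8 * C - 5 / 8 * C ^+ 3)).
  congr (_ + _); rewrite /Hf /derivs /evalR /= -/y E /C /S /Cy /Sy; by field.
rewrite (_ : y * S ^+ 2 = 1 - C ^+ 2); first by field.
by rewrite CS; ring.
Qed.

End at_r.

End sinc_identities.

(** * Normalisation of the profile and its curvature at the equator *)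

Section profile.
Variable R : realType.
Implicit Types t : R.

Fixpoint trig (n : nat) : R -> R :=
  match n with 0 => sin | 1 => cos | m.+2 => fun t => - trig m t end.

Lemma derivatives_trig : derivatives trig.
Proof.
move=> n t; suff [] : is_derive t (1 : R) (trig n) (trig n.+1 t) /\
  is_derive t (1 : R) (trig n.+1) (trig n.+2 t) by [].
elim: n => [|n [h1 h2]].
  by split; [exact: is_derive_sin|exact: is_derive_cos].
by split=> //; exact: is_deriveN.
Qed.

Lemma trig_even k t : trig k.*2 t = (-1) ^+ k * sin t.
Proof.
by elim: k => [|k IH]; rewrite ?mul1r // doubleS /= IH exprS mulN1r mulNr.
Qed.

(** Triple-angle formula with 2t = 3 (2t/3); a sum of two sines has iterated derivatives in closed
    form. *)
Lemma gamma0_sin3 t :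
  gamma0 t = 9 / 16 * sin (2 / 3 * t) + 5 / 16 * sin (2 * t).
Proof.
have -> : 2 * t = 2 / 3 * t + (2 / 3 * t + 2 / 3 * t) by field.
rewrite sinD sinD cosD /gamma0.
set s := sin _; set c := cos _.
have cs : c * c = 1 - s ^+ 2 by rewrite -expr2 /c cos2sin2.
rewrite !mulrDr !mulrA.
transitivity (9 / 16 * s + 5 / 16 * (3 * (c * c) * s - s ^+ 3)); last by field.
by rewrite cs; field.
Qed.

Definition sinesE (a b : R) n : expr R :=
  Add (Mul (Cst a) (App trig n (Mul (Cst (2 / 3)) (Var 0))))
      (Mul (Cst b) (App trig n (Mul (Cst 2) (Var 0)))).

Lemma derivatives_sines a b n : derivatives (derivs (sinesE a b n)).
Proof. by apply: derivativesP => u; move: derivatives_trig => /=; tauto. Qed.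

Lemma derive1n_gamma0E n : derive1n n (@gamma0 R) =
  derivs (sinesE (9 / 16 * (2 / 3) ^+ n) (5 / 16 * 2 ^+ n) n) 0.
Proof.
elim: n => [|n IH].
  by apply/funext => t; rewrite derive1n0 gamma0_sin3 !mulr1.
rewrite derive1nS IH; apply/funext => t; rewrite derive1E.
have [_ ->] :=
  derivatives_sines (9 / 16 * (2 / 3) ^+ n) (5 / 16 * 2 ^+ n) n 0 t.
by rewrite /derivs /evalR /= !exprS; ring.
Qed.

Lemma derive1n_gamma0 n t : derive1n n (@gamma0 R) t =
  9 / 16 * (2 / 3) ^+ n * trig n (2 / 3 * t) + 5 / 16 * 2 ^+ n * trig n (2 * t).
Proof. by rewrite derive1n_gamma0E. Qed.

Lemma derivable_gamma0 n t : derivable (derive1n n (@gamma0 R)) t 1.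
Proof.
rewrite derive1n_gamma0E.
by have [] := derivatives_sines (9 / 16 * (2 / 3) ^+ n) (5 / 16 * 2 ^+ n) n 0 t.
Qed.

Definition ell : R := 3 / 2 * pi.

(** Symmetry about the equator: both polar charts carry the same radial profile. *)
Lemma gamma0_reflect t : gamma0 (ell - t) = gamma0 t.
Proof.
rewrite /gamma0 (_ : 2 / 3 * (ell - t) = - (2 / 3 * t) + pi).
  by rewrite sinDpi sinN opprK.
by rewrite /ell; field.
Qed.

Lemma gamma0_gt0 t : 0 < t < ell -> 0 < gamma0 t.
Proof.
rewrite /ell => /andP[t0 tl]; have s0 : 0 < sin (2 / 3 * t).
  by apply: sin_gt0_pi; lra.
rewrite mulr_gt0 //; have := sin2cos2 (2 / 3 * t).
by have := sqr_ge0 (cos (2 / 3 * t)); lra.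
Qed.

Lemma gamma0_primitive t :
  is_derive t (1 : R)
    (fun u => - (27 / 32) * cos (2 / 3 * u) - 5 / 32 * cos (2 * u)) (gamma0 t).
Proof.
pose f := sinesE (- (27 / 32)) (- (5 / 32)) 1.
set F := (X in is_derive _ _ X).
have -> : F = derivs f 0.
  apply: funext => u; rewrite /F /derivs /evalR /=. ring.
rewrite (_ : gamma0 t = derivs f 1 t); first exact: derivatives_sines.
by rewrite gamma0_sin3 /derivs /evalR /=; field.
Qed.

Lemma continuous_gamma0 : continuous (@gamma0 R).
Proof.
move=> t; apply: differentiable_continuous; apply/derivable1_diffP.
by have := @derivable_gamma0 0%N t; rewrite derive1n0.
Qed.

Lemma integral_gamma0 :
  (\int[lebesgue_measure]_(t in `[0%R, ell]) (gamma0 t)%:E = 2%:E)%E.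
Proof.
have l0 : 0 < ell by rewrite /ell; have := pi_gt0 R; lra.
pose F (u : R) := - (27 / 32) * cos (2 / 3 * u) - 5 / 32 * cos (2 * u).
have FD t : derivable F t 1 by have [] := gamma0_primitive t.
have Fc : continuous F.
  by move=> t; apply: differentiable_continuous; apply/derivable1_diffP.
rewrite (@continuous_FTC2 R _ F _ _ l0).
- rewrite -EFinB; congr _%:E; rewrite /F !mulr0 cos0.
  rewrite (_ : 2 / 3 * ell = pi); last by rewrite /ell; field.
  rewrite (_ : 2 * ell = pi + pi *+ 2); last by rewrite /ell mulr2n; field.
  by rewrite cosD2pi cospi; field.
- by apply: continuous_subspaceT; exact: continuous_gamma0.
- by split; [move=> x _; exact: FD|exact: (cvg_at_right_filter (Fc _))|
    exact: (cvg_at_left_filter (Fc _))].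
- by move=> x _; rewrite derive1E; have [_ ->] := gamma0_primitive x.
Qed.

Lemma normalised_gamma0 : normalised_profile ell (@gamma0 R).
Proof.
have p0 := pi_gt0 R.
have l1 : 2 / 3 * ell = pi by rewrite /ell; field.
have l2 : 2 * ell = pi + pi *+ 2 by rewrite /ell mulr2n; field.
split; first by rewrite /ell; lra.
split.
- exact: derivable_gamma0.
- split; last exact: gamma0_gt0.
    by rewrite /gamma0 mulr0 sin0 mul0r.
  by rewrite /gamma0 l1 sinpi mul0r.
- split.
  + by rewrite derive1n_gamma0 /= !mulr0 cos0; field.
  + by rewrite derive1n_gamma0 /= l1 l2 cosD2pi cospi; field.
  (* The derivative is 3/8 cos (2t/3) + 5/8 cos (2t): the weights sum to 1 and the first cosine lies
     strictly between -1 and 1. *)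
  + move=> t /andP[t0 tl]; rewrite derive1n_gamma0 /= !expr1.
    have c1 : `|cos (2 / 3 * t)| < 1.
      rewrite lt_neqAle cos_max andbT norm_cos_eq1 gt_eqF // sin_gt0_pi //.
      by move: tl; rewrite /ell; lra.
    move: c1; rewrite !ltr_norml; have := cos_geN1 (2 * t).
    by have := cos_le1 (2 * t); lra.
(* Even derivatives are combinations of sin (2t/3) and sin (2t), which vanish at both ends. *)
- move=> k; rewrite !derive1n_gamma0 !trig_even l1 l2 sinD2pi sinpi !mulr0 sin0.
  by rewrite !mulr0 addr0.
- exact: integral_gamma0.
Qed.

Lemma curvature_mid :
  ~ (forall t : R, 0 <= t <= ell -> 0 < magnetic_curvature ell (@gamma0 R) 1 t).
Proof.
have p0 := pi_gt0 R.
move=> /(_ (ell / 2)); rewrite /magnetic_curvature /gauss_curvature.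
have lp : 0 < ell by rewrite /ell; lra.
rewrite (gt_eqF (_ : 0 < ell / 2)) ?(lt_eqF (_ : ell / 2 < ell)); try lra.
rewrite (derive1n_gamma0 2) gamma0_sin3 /=.
rewrite (_ : 2 / 3 * (ell / 2) = pi / 2); last by rewrite /ell; field.
rewrite (_ : 2 * (ell / 2) = pi / 2 + pi); last by rewrite /ell; field.
rewrite sinDpi sin_pihalf; set K := (X in _ -> 0 < X).
have -> : K = - 3 by rewrite /K; field.
move=> h; suff : 0 < - 3 :> R by lra.
by apply: h; lra.
Qed.

End profile.

(** * Linear coordinates on the plane and its tangent bundle *)

Section coordinates.
Variable R : realType.
Local Notation plane := 'rV[R]_2.
Local Notation tplane := (plane * plane)%type.

Definition coord (i : nat) (p : tplane) : R :=
  match i with 0 => p.1 0 0 | 1 => p.1 0 1 | 2 => p.2 0 0 | _ => p.2 0 1 end.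

Definition pcoord (i : nat) (q : plane) : R :=
  match i with 0 => q 0 0 | _ => q 0 1 end.

Lemma is_diff_linear (V W : normedModType R) (f : V -> W) p :
  linear f -> continuous f -> is_diff p f f.
Proof.
move=> lf cf; pose fM := GRing.isLinear.Build _ _ _ _ f lf.
pose fL : {linear V -> W} := HB.pack f fM.
have -> : f = fL by [].
by apply: DiffDef; [exact: linear_differentiable|exact: diff_lin].
Qed.

Lemma is_diff_pcoord i (q : plane) :
  is_diff q (pcoord i : plane -> R^o) (pcoord i : plane -> R^o).
Proof.
apply: is_diff_linear => [k u v|]; first by case: i => [|i]; rewrite /= !mxE.
by case: i => [|i] /=; exact: coord_continuous.
Qed.

Lemma is_diff_coord i (p : tplane) :
  is_diff p (coord i : tplane -> R^o) (coord i : tplane -> R^o).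
Proof.
apply: is_diff_linear => [k u v|].
  by case: i => [|[|[|i]]]; rewrite /= !mxE.
case: i => [|[|[|i]]] /= u.
- exact: (continuous_comp (@cvg_fst _ _ (nbhs u.1) (nbhs u.2) _)
    (@coord_continuous _ _ _ 0 0 u.1)).
- exact: (continuous_comp (@cvg_fst _ _ (nbhs u.1) (nbhs u.2) _)
    (@coord_continuous _ _ _ 0 1 u.1)).
- exact: (continuous_comp (@cvg_snd _ _ (nbhs u.1) (nbhs u.2) _)
    (@coord_continuous _ _ _ 0 0 u.2)).
- exact: (continuous_comp (@cvg_snd _ _ (nbhs u.1) (nbhs u.2) _)
    (@coord_continuous _ _ _ 0 1 u.2)).
Qed.

Lemma coord_linear k (u v : tplane) :
  coord^~ (k *: u + v) = fun i => k * coord i u + coord i v.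
Proof. by apply/funext; case=> [|[|[|i]]]; rewrite /= !mxE. Qed.

End coordinates.
Arguments coord {R}.
Arguments pcoord {R}.

(** * The candidate contact form and the exterior derivatives of its terms *)

Section surface_forms.
Variable R : realType.
Local Notation plane := 'rV[R]_2.
Local Notation tplane := (plane * plane)%type.
Implicit Types (x y z : nat -> R) (a b e : expr R).

(* The variables 0, 1 stand for the base point q and 2, 3 for the tangent
   vector v; the environments [y] are the coordinates of a vector tangent to
   the tangent bundle. [root1] and [root2] are the components of A_q (a, b),
   [lamE] is the Liouville form, [areaE] is Gamma dtheta, [rotE] is w x dw. *)
Definition Opp e : expr R := Mul (Cst (- 1)) e.
Definition q1 : expr R := Var 0.
Definition q2 : expr R := Var 1.
Definition normE : expr R := Add (Mul q1 q1) (Mul q2 q2).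
Definition hE : expr R := App (@Hf R) 0 normE.
Definition bE : expr R := App (@Bf R) 0 normE.
Definition crossE a b : expr R := Add (Mul q1 b) (Opp (Mul q2 a)).
Definition root1 a b : expr R := Add a (Opp (Mul hE (Mul (crossE a b) q2))).
Definition root2 a b : expr R := Add b (Mul hE (Mul (crossE a b) q1)).
Definition w1 : expr R := root1 (Var 2) (Var 3).
Definition w2 : expr R := root2 (Var 2) (Var 3).
Definition lamE y : expr R :=
  Add (Mul w1 (root1 (Cst (y 0%N)) (Cst (y 1%N))))
      (Mul w2 (root2 (Cst (y 0%N)) (Cst (y 1%N)))).
Definition areaE y : expr R := Mul bE (crossE (Cst (y 0%N)) (Cst (y 1%N))).
Definition rotE y : expr R :=
  Add (Mul w1 (symderiv y w2)) (Opp (Mul w2 (symderiv y w1))).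
Definition formE (eps : R) y : expr R :=
  Add (lamE y) (Mul (Cst eps) (Add (Opp (areaE y)) (rotE y))).
Definition energyE : expr R := Mul (Cst 2^-1) (Add (Mul w1 w1) (Mul w2 w2)).

Definition form (i : bool) : one_form tplane :=
  fun p xi => eval (coord^~ p) (formE ((-1) ^+ i) (coord^~ xi)).

Definition normq x : R := x 0%N * x 0%N + x 1%N * x 1%N.

Lemma defined_w1 x : defined x w1.
Proof. by rewrite /=; have := @derivatives_Hf R; tauto. Qed.

Lemma defined_w2 x : defined x w2.
Proof. by rewrite /=; have := @derivatives_Hf R; tauto. Qed.

Lemma defined_form x y eps : defined x (formE eps y).
Proof.
have hH := @derivatives_Hf R; have hB := @derivatives_Bf R.
by rewrite /=; tauto.
Qed.

Lemma sqrt_norm x : Num.sqrt (normq x) ^+ 2 = normq x.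
Proof. by rewrite sqr_sqrtr // /normq -!expr2 addr_ge0 ?sqr_ge0. Qed.

(** Leibniz rule for lambda = w . sigma, with sigma the coframe A_q dq: four terms come from dw, the
    last one is w . d sigma. Its factor 3 H + 2 s H' is (gamma' - 1) / s. *)
Lemma symderiv_lamE x y z :
  eval x (symderiv y (lamE z)) - eval x (symderiv z (lamE y)) =
  eval x (symderiv y w1) * eval x (root1 (Cst (z 0%N)) (Cst (z 1%N)))
  + eval x (symderiv y w2) * eval x (root2 (Cst (z 0%N)) (Cst (z 1%N)))
  - eval x (symderiv z w1) * eval x (root1 (Cst (y 0%N)) (Cst (y 1%N)))
  - eval x (symderiv z w2) * eval x (root2 (Cst (y 0%N)) (Cst (y 1%N)))
  + (3 * Hf 0 (normq x) + 2 * normq x * Hf 1 (normq x))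
    * (y 0%N * z 1%N - y 1%N * z 0%N)
    * (x 0%N * eval x w2 - x 1%N * eval x w1).
Proof.
rewrite /lamE; move: (w1) (w2) => e1 e2 /=; rewrite -/(normq x).
set d1 := eval x (symderiv y e1); set d2 := eval x (symderiv y e2).
set d1' := eval x (symderiv z e1); set d2' := eval x (symderiv z e2).
move: (Hf 0 (normq x)) (Hf 1 (normq x)) => h0 h1; by rewrite /normq; ring.
Qed.

(** This is d(w x dw) = 2 dw1 /\ dw2. *)
Lemma symderiv_rotE x y z :
  eval x (symderiv y (rotE z)) - eval x (symderiv z (rotE y)) =
  2 * (eval x (symderiv y w1) * eval x (symderiv z w2)
       - eval x (symderiv y w2) * eval x (symderiv z w1)).
Proof.
rewrite /rotE; move: (w1) (w2) => e1 e2 /=.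
by rewrite (symderivC x z y e1) (symderivC x z y e2); ring.
Qed.

(** In Euclidean coordinates d(Gamma dtheta) has density gamma / r, by [Bf_ode] at r = |q|. *)
Lemma symderiv_areaE x y z :
  eval x (symderiv y (areaE z)) - eval x (symderiv z (areaE y)) =
  (1 + normq x * Hf 0 (normq x)) * (y 0%N * z 1%N - y 1%N * z 0%N).
Proof.
have := Bf_ode (Num.sqrt (normq x)); rewrite sqrt_norm => ode.
have -> : 1 + normq x * Hf 0 (normq x) =
    2 * (Bf 0 (normq x) + normq x * Bf 1 (normq x)).
  by rewrite ode; field.
rewrite /= -/(normq x); move: (Bf 0 (normq x)) (Bf 1 (normq x)) => b0 b1.
by rewrite /normq; ring.
Qed.

End surface_forms.

(** * Metric, level and primitive in one polar chart *)

Section surface_geometry.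
Variable R : realType.
Local Notation plane := 'rV[R]_2.
Local Notation tplane := (plane * plane)%type.
Implicit Types (x y z : nat -> R) (q u v : plane) (p xi eta : tplane).

(** The components of A_q u, on vectors rather than on expressions. *)
Definition rt1 q u : R := u 0 0 - Hf 0 (dotp q q) * cross q u * q 0 1.
Definition rt2 q u : R := u 0 1 + Hf 0 (dotp q q) * cross q u * q 0 0.

Lemma normq_coord p : normq (coord^~ p) = dotp p.1 p.1.
Proof. by []. Qed.

Lemma eval_w1 p : eval (coord^~ p) (w1 R) = rt1 p.1 p.2.
Proof. by rewrite /= /rt1 /cross /dotp; ring. Qed.

Lemma eval_w2 p : eval (coord^~ p) (w2 R) = rt2 p.1 p.2.
Proof. by rewrite /= /rt2 /cross /dotp; ring. Qed.

Lemma eval_root1 p u :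
  eval (coord^~ p) (root1 (Cst (u 0 0)) (Cst (u 0 1))) = rt1 p.1 u.
Proof. by rewrite /= /rt1 /cross /dotp; ring. Qed.

Lemma eval_root2 p u :
  eval (coord^~ p) (root2 (Cst (u 0 0)) (Cst (u 0 1))) = rt2 p.1 u.
Proof. by rewrite /= /rt2 /cross /dotp; ring. Qed.

Lemma eucl_eq0 q : (eucl q == 0) = (q == 0).
Proof.
apply/idP/eqP => [|->]; last by rewrite /eucl /dotp !mxE !mul0r addr0 sqrtr0.
rewrite /eucl sqrtr_eq0 /dotp -!expr2 => h.
have := sqr_ge0 (q 0 0); have := sqr_ge0 (q 0 1) => h1 h2.
have : q 0 0 ^+ 2 = 0 by lra.
have : q 0 1 ^+ 2 = 0 by lra.
move=> /eqP; rewrite sqrf_eq0 => /eqP a /eqP; rewrite sqrf_eq0 => /eqP b.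
by apply: planeP; rewrite mxE.
Qed.

Lemma gamma0_height i q : gamma0 (height (ell R) i q) = gamma0 (eucl q).
Proof. by case: i; rewrite //= gamma0_reflect. Qed.

(** This is gamma(r) / r extended to the centre, and also det A_q. *)
Definition stretch q : R := 1 + dotp q q * Hf 0 (dotp q q).

Lemma gamma0_eucl q : gamma0 (eucl q) = eucl q * stretch q.
Proof. by rewrite gamma0E -dotpp. Qed.

(** A_q fixes the radial vector q and multiplies Jq by gamma / r, so its square gives the metric, in
    either chart by [gamma0_reflect]. *)
Lemma metricE i q u v : metric (ell R) (@gamma0 R) i q u v =
  rt1 q u * rt1 q v + rt2 q u * rt2 q v.
Proof.
rewrite /metric gamma0_height gamma0_eucl; case: eqVneq => [->|q0].
  by rewrite /rt1 /rt2 /dotp /cross !mxE; ring.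
have r0 : eucl q != 0 by rewrite eucl_eq0.
rewrite /dheight /dangle.
have s0 : dotp q q != 0 by rewrite dotpp expf_neq0.
transitivity ((dotp q u * dotp q v + stretch q ^+ 2 * (cross q u * cross q v))
    / dotp q q).
  move: (stretch q) (sqrr_sign R i) => G; move: ((-1) ^+ i) => e e2.
  rewrite !(dotpp q).
  move: (dotp q u) (dotp q v) (cross q u) (cross q v) => a b c d.
  transitivity (e ^+ 2 * (a * b / eucl q ^+ 2)
    + G ^+ 2 * (c * d) / eucl q ^+ 2).
    by field.
  by rewrite e2; field.
apply: (mulIf s0); rewrite divfK // /rt1 /rt2 /stretch.
by move: (Hf 0 (dotp q q)) => h; rewrite /dotp /cross; ring.
Qed.

Lemma areaP i q u v : area (ell R) (@gamma0 R) i q u v =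
  (-1) ^+ i * (stretch q * cross u v).
Proof.
rewrite /area gamma0_height gamma0_eucl; case: eqVneq => [->|q0].
  by rewrite /stretch /dotp !mxE; ring.
have r0 : eucl q != 0 by rewrite eucl_eq0.
have s0 : dotp q q != 0 by rewrite dotpp expf_neq0.
rewrite /dheight /dangle.
transitivity ((-1) ^+ i * stretch q *
   ((dotp q u * cross q v - dotp q v * cross q u) / dotp q q)).
  by field; rewrite r0 s0.
rewrite -mulrA; congr (_ * (_ * _)); apply: (mulIf s0); rewrite divfK //.
by rewrite /dotp /cross; ring.
Qed.

Lemma liouvilleE i : liouville (ell R) (@gamma0 R) i =
  fun p xi => eval (coord^~ p) (lamE (coord^~ xi)).
Proof.
apply/funext => p; apply/funext => xi.
by rewrite /liouville metricE -eval_w1 -eval_w2 -!eval_root1 -!eval_root2.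
Qed.

Lemma energyP i : energy (ell R) (@gamma0 R) i = func coord (energyE R).
Proof.
by apply/funext => p; rewrite /energy metricE -eval_w1 -eval_w2 /func /= mulrC.
Qed.

Lemma eval_form x eps y : eval x (formE eps y) = eval x (lamE y)
  + eps * (- eval x (areaE y) + (eval x (w1 R) * eval x (symderiv y (w2 R))
                                 - eval x (w2 R) * eval x (symderiv y (w1 R)))).
Proof.
rewrite /formE /rotE; move: (lamE y) (areaE y) => l a.
by move: (w1 R) (w2 R) => e1 e2 /=; ring.
Qed.

Lemma smooth_form i : smooth_one_form setT (@form R i).
Proof.
split=> [p _ k u v|v].
  rewrite /form coord_linear ; move: (coord^~ p) => x.
  rewrite !eval_form !symderiv_linear /GRing.scale.
  have -> : eval x (lamE (fun i => k * coord i u + coord i v)) =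
    k * eval x (lamE (coord^~ u)) + eval x (lamE (coord^~ v)).
    by rewrite /=; ring.
  have -> : eval x (areaE (fun i => k * coord i u + coord i v)) =
    k * eval x (areaE (coord^~ u)) + eval x (areaE (coord^~ v)).
    by rewrite /=; ring.
  by rewrite /GRing.scale /=; ring.
apply: smooth_func => [j p|p]; [exact: is_diff_coord|exact: defined_form].
Qed.

Lemma ext_deriv_eval (f : (nat -> R) -> expr R) p xi eta :
  (forall x y, defined x (f y)) ->
  ext_deriv (fun p xi => eval (coord^~ p) (f (coord^~ xi))) p xi eta =
  eval (coord^~ p) (symderiv (coord^~ xi) (f (coord^~ eta)))
  - eval (coord^~ p) (symderiv (coord^~ eta) (f (coord^~ xi))).
Proof.
by move=> df; rewrite /ext_deriv !(derive_func (@is_diff_coord R)).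
Qed.

Lemma level_rt i p : level (ell R) (@gamma0 R) 1 i p ->
  eucl p.1 < ell R /\ rt1 p.1 p.2 ^+ 2 + rt2 p.1 p.2 ^+ 2 = 1.
Proof.
by case=> d; rewrite /energy metricE -!expr2 expr1n => e; split=> //; lra.
Qed.

Definition dw1 p xi := eval (coord^~ p) (symderiv (coord^~ xi) (w1 R)).
Definition dw2 p xi := eval (coord^~ p) (symderiv (coord^~ xi) (w2 R)).

Lemma level_tangentE i p xi : level_tangent (ell R) (@gamma0 R) i p xi <->
  rt1 p.1 p.2 * dw1 p xi + rt2 p.1 p.2 * dw2 p xi = 0.
Proof.
rewrite /level_tangent /= energyP (derive_func (@is_diff_coord R)); last first.
  by have := @derivatives_Hf R; rewrite /=; tauto.
rewrite -eval_w1 -eval_w2 /dw1 /dw2 /func /energyE.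
move: (w1 R) (w2 R) => e1 e2 /=; split=> h; lra.
Qed.

Lemma ext_deriv_form i p xi eta : ext_deriv (form i) p xi eta =
  ext_deriv (liouville (ell R) (@gamma0 R) i) p xi eta
  + (-1) ^+ i * (- (stretch p.1 * cross xi.1 eta.1)
      + 2 * (dw1 p xi * dw2 p eta - dw2 p xi * dw1 p eta)).
Proof.
rewrite liouvilleE !ext_deriv_eval; last 2 first.
- by move=> x y; have := @derivatives_Hf R; rewrite /=; tauto.
- by move=> x y; exact: defined_form.
have : _ = stretch p.1 * cross xi.1 eta.1 :=
  symderiv_areaE (coord^~ p) (coord^~ xi) (coord^~ eta).
have : _ = 2 * (dw1 p xi * dw2 p eta - dw2 p xi * dw1 p eta) :=
  symderiv_rotE (coord^~ p) (coord^~ xi) (coord^~ eta).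
rewrite /formE; move: (dw1 p _) (dw1 p _) (dw2 p _) (dw2 p _) => d1 d2 d3 d4.
move: (lamE _) (lamE _) (areaE _) (areaE _) (rotE _) (rotE _).
by move=> l1 l2 a1 a2 r1 r2 /= <- <-; ring.
Qed.

Lemma ext_deriv_liouville i p xi eta :
  ext_deriv (liouville (ell R) (@gamma0 R) i) p xi eta =
  dw1 p xi * rt1 p.1 eta.1 + dw2 p xi * rt2 p.1 eta.1
  - dw1 p eta * rt1 p.1 xi.1 - dw2 p eta * rt2 p.1 xi.1
  + (3 * Hf 0 (dotp p.1 p.1) + 2 * dotp p.1 p.1 * Hf 1 (dotp p.1 p.1))
    * cross xi.1 eta.1 * (stretch p.1 * cross p.1 p.2).
Proof.
rewrite liouvilleE ext_deriv_eval; last first.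
  by move=> x y; have := @derivatives_Hf R; rewrite /=; tauto.
rewrite symderiv_lamE normq_coord -!eval_root1 -!eval_root2 /dw1 /dw2.
congr (_ + _ * _); rewrite eval_w1 eval_w2 /= /rt1 /rt2 /stretch.
by move: (Hf 0 (dotp p.1 p.1)) => h; rewrite /dotp /cross; ring.
Qed.

(** On the level |w| = 1, so dw is orthogonal to w on tangent vectors, and two such values of dw are
    parallel. *)
Lemma tangent_rot0 i p xi eta : level (ell R) (@gamma0 R) 1 i p ->
  level_tangent (ell R) (@gamma0 R) i p xi ->
  level_tangent (ell R) (@gamma0 R) i p eta ->
  dw1 p xi * dw2 p eta - dw2 p xi * dw1 p eta = 0.
Proof.
move=> /level_rt[_ w] /level_tangentE h1 /level_tangentE h2.
move: w h1 h2; move: (rt1 _ _) (rt2 _ _) => a b.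
move: (dw1 _ _) (dw1 _ _) (dw2 _ _) (dw2 _ _) => c2 c1 d2 d1 w h1 h2.
transitivity ((a ^+ 2 + b ^+ 2) * (c1 * d2 - d1 * c2)).
  by rewrite w mul1r.
transitivity ((a * c1 + b * d1) * (a * d2 - b * c2)
  - (a * c2 + b * d2) * (a * d1 - b * c1)).
  by ring.
by rewrite h1 h2 !mul0r subr0.
Qed.

(** The rotation term drops out by [tangent_rot0], and the sign in [form] is the one in [areaP]:
    what remains is d lambda minus the area form. *)
Lemma primitive_form : primitive_on_level (ell R) (@gamma0 R) 1 (@form R).
Proof.
move=> i p xi eta lp t1 t2.
by rewrite ext_deriv_form (tangent_rot0 lp t1 t2) /omega areaP; ring.
Qed.

(** * Frames of the level, the bound on beta and the contact condition *)

Lemma stretch_gt0 q : eucl q < ell R -> 0 < stretch q.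
Proof.
move=> ql; have [q0|q0] := eqVneq q 0.
  by rewrite /stretch q0 /dotp !mxE !mul0r addr0 mul0r addr0.
have r0 : 0 < eucl q by rewrite lt_neqAle sqrtr_ge0 eq_sym eucl_eq0 q0.
have := @gamma0_gt0 R (eucl q); rewrite r0 ql gamma0_eucl pmulr_rgt0 //.
exact.
Qed.

Lemma rt_surj q (c1 c2 : R) : eucl q < ell R ->
  exists u : plane, rt1 q u = c1 /\ rt2 q u = c2.
Proof.
(* The equation A_q u = c forces q x u to be k, by taking the cross product with q; then u = c - h k
   Jq. *)
move=> /stretch_gt0 G0; pose k := (q 0 0 * c2 - q 0 1 * c1) / stretch q.
pose h := Hf 0 (dotp q q).
pose u : plane := \row_(j < 2)
  (if j == 0 then c1 + h * k * q 0 1 else c2 - h * k * q 0 0).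
exists u.
have -> : rt1 q u = c1 + h * (k - cross q u) * q 0 1.
  by rewrite /rt1 !mxE /= -/h; ring.
have -> : rt2 q u = c2 - h * (k - cross q u) * q 0 0.
  by rewrite /rt2 !mxE /= -/h; ring.
have -> : cross q u = k.
  transitivity (k * stretch q - k * (dotp q q * h)).
    rewrite {1}/k divfK ?gt_eqF // /cross !mxE /= /dotp; ring.
  by rewrite /stretch -/h; ring.
by rewrite subrr !mulr0 !mul0r addr0 subr0.
Qed.

Lemma cross_rt q u v :
  rt1 q u * rt2 q v - rt2 q u * rt1 q v = stretch q * cross u v.
Proof.
rewrite /rt1 /rt2 /stretch; move: (Hf 0 (dotp q q)) => h.
by rewrite /dotp /cross; ring.
Qed.

Lemma cross_rt_radial q v :
  q 0 0 * rt2 q v - q 0 1 * rt1 q v = stretch q * cross q v.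
Proof.
rewrite /rt1 /rt2 /stretch; move: (Hf 0 (dotp q q)) => h.
by rewrite /dotp /cross; ring.
Qed.

(** Since w is linear in v, the fibre component z adds A_q z to dw. *)
Lemma dw_split p (u z : plane) :
  dw1 p (u, z) = dw1 p (u, 0) + rt1 p.1 z /\
  dw2 p (u, z) = dw2 p (u, 0) + rt2 p.1 z.
Proof.
have E : coord^~ (u, z) = fun i => 1 * coord i (u, 0) + coord i (0, z).
  by apply/funext; case=> [|[|[|i]]]; rewrite /= !mxE; ring.
rewrite /dw1 /dw2 E !symderiv_linear !mul1r; split; congr (_ + _).
  by rewrite /= /rt1 /cross /dotp !mxE; ring.
by rewrite /= /rt2 /cross /dotp !mxE; ring.
Qed.

Lemma dw_surj p (u : plane) (c1 c2 : R) : eucl p.1 < ell R ->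
  exists z : plane, dw1 p (u, z) = c1 /\ dw2 p (u, z) = c2.
Proof.
move=> /(@rt_surj _ (c1 - dw1 p (u, 0)) (c2 - dw2 p (u, 0)))[z [h1 h2]].
by exists z; have [-> ->] := dw_split p u z; rewrite h1 h2 !subrKC.
Qed.

(** The coefficient (Gamma + gamma' - 1) / s, so that beta(u) is its product with q x u. *)
Definition beta_of q : R :=
  3 * Hf 0 (dotp q q) + 2 * dotp q q * Hf 1 (dotp q q) + Bf 0 (dotp q q).

(** With x = 2|q|/3 and |v|_g = 1, |dtheta(v)| is at most 1 / gamma, so 15/8 |cos x| sin^2 x < 2
    gamma suffices. Dividing by sin x and squaring leaves a quadratic inequality in sin^2 x. *)
Lemma beta_bound q v : eucl q < ell R -> rt1 q v ^+ 2 + rt2 q v ^+ 2 = 1 ->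
  `|beta_of q * cross q v| < 2.
Proof.
move=> ql w; have [q0|q0] := eqVneq q 0.
  by rewrite q0 /cross !mxE !mul0r subrr mulr0 normr0.
have r0 : 0 < eucl q by rewrite lt_neqAle sqrtr_ge0 eq_sym eucl_eq0 q0.
have bs := beta_coef (eucl q); rewrite -dotpp -/(beta_of q) in bs.
have g := gamma0_eucl q; rewrite /gamma0 in g.
have xin : 0 < 2 / 3 * eucl q < pi by move: ql; rewrite /ell; lra.
have sg : 0 < sin (2 / 3 * eucl q) by exact: sin_gt0_pi.
have cs := cos2sin2 (2 / 3 * eucl q).
(* Cauchy-Schwarz for q and w: the two sides differ by (q . w)^2. *)
have kap : (stretch q * cross q v) ^+ 2 <= dotp q q.
  rewrite -cross_rt_radial /dotp -[leRHS]mulr1 -w -subr_ge0.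
  set e := (X in 0 <= X).
  have -> : e = (q 0 0 * rt1 q v + q 0 1 * rt2 q v) ^+ 2.
    by rewrite /e; ring.
  exact: sqr_ge0.
have s0 : 0 < dotp q q by rewrite dotpp exprn_gt0.
move: bs g sg cs kap.
move: (beta_of q) (sin _) (cos _) (cross q v) (stretch q).
move=> b s c k G bs g sg cs kap.
rewrite -(@ltr_pXn2r _ 2) ?nnegrE // real_normK ?num_real //.
pose P := s * (3 / 2 - 5 / 4 * s ^+ 2).
have P0 : 0 < P.
  rewrite /P mulr_gt0 //; have : 0 <= c ^+ 2 by exact: sqr_ge0.
  lra.
have e1 : (b * k) ^+ 2 * P ^+ 2 * dotp q q = (dotp q q * b) ^+ 2 * (G * k) ^+ 2.
  by rewrite /P g dotpp; ring.
have e2 : (b * k) ^+ 2 * P ^+ 2 <= (15 / 8 * c * s ^+ 2) ^+ 2.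
  rewrite -(ler_pM2r s0) e1 bs mulNr mulNr.
  by rewrite sqrrN ler_wpM2l // sqr_ge0.
have e3 : (15 / 8 * c * s ^+ 2) ^+ 2 < 2 ^+ 2 * P ^+ 2.
  have s2 : 0 < s ^+ 2 by rewrite exprn_gt0.
  have -> : (15 / 8 * c * s ^+ 2) ^+ 2 = s ^+ 2 * (225 / 64 * c ^+ 2 * s ^+ 2).
    by field.
  have -> : 2 ^+ 2 * P ^+ 2 = s ^+ 2 * (4 * (3 / 2 - 5 / 4 * s ^+ 2) ^+ 2).
    by rewrite /P; ring.
  rewrite ltr_pM2l // cs; move: (s ^+ 2) => t.
  rewrite -subr_gt0; set D := (X in 0 < X).
  (* The quadratic 9 - 1185/64 t + 625/64 t^2 with its square completed; its minimum is positive. *)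
  have -> : D = 625 / 64 * (t - 237 / 250) ^+ 2 + 1431 / 6400.
    by rewrite /D; field.
  by have := sqr_ge0 (t - 237 / 250); lra.
have P2 : 0 < P ^+ 2 by rewrite exprn_gt0.
by rewrite -(ltr_pM2r P2) (le_lt_trans e2).
Qed.

Lemma formP i p xi : form i p xi =
  rt1 p.1 p.2 * rt1 p.1 xi.1 + rt2 p.1 p.2 * rt2 p.1 xi.1
  + (-1) ^+ i * (- (Bf 0 (dotp p.1 p.1) * cross p.1 xi.1)
      + (rt1 p.1 p.2 * dw2 p xi - rt2 p.1 p.2 * dw1 p xi)).
Proof.
rewrite /form eval_form -/(dw1 p xi) -/(dw2 p xi).
rewrite -eval_w1 -eval_w2 -eval_root1 -eval_root2.
congr (_ + _ * (- _ + _)).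
by rewrite /= /cross /dotp; ring.
Qed.

(** With eps the sign of the chart, a /\ da takes the value eps beta(v) - 2 on the frame below,
    which is nonzero by [beta_bound]. *)
Lemma contact_form : contact_on_level (ell R) (@gamma0 R) 1 (@form R).
Proof.
move=> i p lp; have [pl w] := level_rt lp.
(* Here [n] is the unit normal to v. The frame is the rotation of the fibre, with dw = Jw, followed
   by the lifts of v and [n] with dw = 0. *)
have [n [n1 n2]] := rt_surj (- rt2 p.1 p.2) (rt1 p.1 p.2) pl.
have [zX [X1 X2]] := dw_surj p.2 0 0 pl.
have [zY [Y1 Y2]] := dw_surj n 0 0 pl.
have [zV [V1 V2]] := dw_surj 0 (- rt2 p.1 p.2) (rt1 p.1 p.2) pl.
exists (0, zV), (p.2, zX), (n, zY).
have tX : level_tangent (ell R) (@gamma0 R) i p (p.2, zX).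
  by apply/level_tangentE; rewrite X1 X2 !mulr0 addr0.
have tY : level_tangent (ell R) (@gamma0 R) i p (n, zY).
  by apply/level_tangentE; rewrite Y1 Y2 !mulr0 addr0.
have tV : level_tangent (ell R) (@gamma0 R) i p (0, zV).
  by apply/level_tangentE; rewrite V1 V2; ring.
split=> //.
have Gn : stretch p.1 * cross p.2 n = 1.
  by rewrite -cross_rt n1 n2 -w; ring.
have z1 (q : plane) : rt1 q 0 = 0 by rewrite /rt1 /cross !mxE; ring.
have z2 (q : plane) : rt2 q 0 = 0 by rewrite /rt2 /cross !mxE; ring.
have zc (q : plane) : cross q 0 = 0 by rewrite /cross !mxE; ring.
have cz (q : plane) : cross 0 q = 0 by rewrite /cross !mxE; ring.
rewrite /wedge12 !(primitive_form lp) // /omega.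
rewrite !ext_deriv_liouville !areaP !formP.
rewrite V1 V2 X1 X2 Y1 Y2 /= n1 n2 !z1 !z2 !zc !cz.
have := beta_bound pl w; rewrite /beta_of.
have := sqrr_sign R i; have := normr_sign R i; move: ((-1) ^+ i) => e ne e2.
move: w Gn; move: (rt1 _ _) (rt2 _ _) (stretch _).
move: (cross _ n) (cross p.1 n) (Bf _ _).
move: (_ + _ * Hf 1 _) (cross _ _) => K k c d B a b G w Gn bb.
set W := (X in X != 0).
have -> : W = e * ((K + B) * k) - 2.
  transitivity (e * (a ^+ 2 + b ^+ 2) * (K * k * (G * c) - e * (G * c))
    + (a ^+ 2 + b ^+ 2 - e * (B * k)) * - (a ^+ 2 + b ^+ 2)).
    by rewrite /W; ring.
  rewrite w Gn; transitivity (e * ((K + B) * k) - e ^+ 2 - 1); first by ring.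
  by rewrite e2; ring.
rewrite subr_eq0; apply/eqP => h.
have := congr1 Num.norm h; rewrite normrM ne mul1r => h'.
by move: bb; rewrite h' gtr0_norm ?ltxx.
Qed.

End surface_geometry.

(** * Agreement of the two forms under the change of charts *)

Section gluing.
Variable R : realType.
Local Notation plane := 'rV[R]_2.
Local Notation tplane := (plane * plane)%type.
Local Notation l := (ell R).
Implicit Types (q u v : plane) (p xi : tplane).

(** This is 1 / |q|; then [trE] is the component (l / |q| - 1) q_j of the change of charts, and
    [dtrE] its derivative along v. *)
Definition rhoE : expr R := Rsqrt (normE R).
Definition trE j : expr R := Mul (Add (Mul (Cst l) rhoE) (Cst (- 1))) (Var j).
Definition dotE : expr R := Add (Mul (Var 0) (Var 2)) (Mul (Var 1) (Var 3)).
Definition dtrE j : expr R :=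
  Add (Mul (Add (Mul (Cst l) rhoE) (Cst (- 1))) (Var j.+2))
      (Opp (Mul (Mul (Cst l) (Mul rhoE (Mul rhoE rhoE))) (Mul dotE (Var j)))).
(** For [e] the component of w along q_j, this is the same component of the reflection of w in the
    line orthogonal to q. *)
Definition reflE j e : expr R := Add e (Mul (Cst (- 2))
  (Mul (Mul (Mul rhoE rhoE) (Add (Mul (Var 0) (w1 R)) (Mul (Var 1) (w2 R))))
       (Var j))).

Lemma dotp_neq0 q : (dotp q q != 0) = (q != 0).
Proof. by rewrite dotpp sqrf_eq0 eucl_eq0. Qed.

Lemma dotp_gt0 q : q != 0 -> 0 < dotp q q.
Proof. by rewrite -dotp_neq0 dotpp lt_neqAle eq_sym sqr_ge0 andbT. Qed.

Lemma near_pcoord_neq0 q : q != 0 -> \forall q' \near q, q' != 0.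
Proof.
move=> q0; have c : {for q, continuous (func pcoord (normE R))}.
  apply: differentiable_continuous; apply: differentiable_func => // i r.
  exact: is_diff_pcoord.
have : \forall q' \near q, func pcoord (normE R) q' != 0.
  by apply: (cvgr_neq0 _ c); rewrite (dotp_neq0 q).
by apply: filterS => q'; rewrite (dotp_neq0 q').
Qed.

Lemma near_coord_neq0 p : p.1 != 0 -> \forall p' \near p, p'.1 != 0.
Proof.
move=> q0; have c : {for p, continuous (func coord (normE R))}.
  apply: differentiable_continuous; apply: differentiable_func => // i r.
  exact: is_diff_coord.
have : \forall p' \near p, func coord (normE R) p' != 0.
  by apply: (cvgr_neq0 _ c); rewrite (dotp_neq0 p.1).
by apply: filterS => q'; rewrite (dotp_neq0 q'.1).
Qed.

Lemma transE q : q != 0 ->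
  trans l q = \row_(j < 2) func pcoord (trE j) q.
Proof.
rewrite -eucl_eq0 => r0; apply: planeP; rewrite !mxE /func /=.
  by rewrite -/(dotp q q) -/(eucl q); field.
by rewrite -/(dotp q q) -/(eucl q); field.
Qed.

Lemma defined_trE q j : q != 0 -> defined (pcoord^~ q) (trE j).
Proof. by move=> /dotp_gt0; rewrite /dotp /=; tauto. Qed.

Lemma derive_trans q v : q != 0 ->
  'D_v (trans l) q = \row_(j < 2) eval (coord^~ (q, v)) (dtrE j).
Proof.
move=> q0; pose f q := \row_(j < 2) func pcoord (trE j) q : plane.
have nf : \forall q' \near q, trans l q' = f q'.
  by apply: filterS (near_pcoord_neq0 q0) => q'; exact: transE.
rewrite (near_eq_derive _ nf).
have fE j : (fun q => f q 0 j) = func pcoord (trE j).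
  by apply/funext => q'; rewrite mxE.
have dj j := differentiable_func (@is_diff_pcoord R) (@defined_trE q j q0).
rewrite derive_mx; last first.
  apply/derivable_mxP => i j; rewrite (ord1 i) fE; exact: diff_derivable (dj _).
have e j : (j < 2)%N ->
    eval (pcoord^~ q) (symderiv (pcoord^~ v) (trE j)) =
    eval (coord^~ (q, v)) (dtrE j).
  by case: j => [|[|j]] //= _; move: (Num.sqrt _)^-1 => r; field.
apply/rowP => j; rewrite !mxE fE (derive_func (@is_diff_pcoord R)).
  by rewrite -e.
exact: defined_trE.
Qed.

Let unitv (j : nat) : plane := \row_(k < 2) (k == j :> nat)%:R.
(** The map [ttrans] away from the centre, as a combination of constant vectors, so that it is
    differentiable as soon as the coefficients are. *)
Definition ttr p : tplane :=
  func coord (trE 0) p *: (unitv 0, 0) + func coord (trE 1) p *: (unitv 1, 0)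
  + func coord (dtrE 0) p *: (0, unitv 0)
  + func coord (dtrE 1) p *: (0, unitv 1).

Lemma ttransE p : p.1 != 0 -> ttrans l p = ttr p.
Proof.
move=> p0; rewrite /ttrans transE // derive_trans //.
congr pair; apply: planeP;
  by rewrite !mxE /func /= !(mulr1, mulr0, addr0, add0r).
Qed.

Lemma defined_ttr p j : p.1 != 0 ->
  defined (coord^~ p) (trE j) /\ defined (coord^~ p) (dtrE j).
Proof. by move=> /dotp_gt0; rewrite /dotp /=; tauto. Qed.

Lemma differentiable_ttr p : p.1 != 0 -> differentiable ttr p.
Proof.
move=> p0; have d j := @defined_ttr p j p0.
by do ?[apply: differentiableD]; apply: differentiableZl;
  apply: (differentiable_func (@is_diff_coord R)); case: (d 0); case: (d 1).
Qed.

(** Chain rule: an identity between expressions across the change of charts, valid near p, may be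
    differentiated. *)
Lemma symderiv_ttr p xi e e' : p.1 != 0 -> defined (coord^~ (ttr p)) e ->
  defined (coord^~ p) e' ->
  (\forall p' \near p, func coord e (ttr p') = func coord e' p') ->
  eval (coord^~ (ttr p)) (symderiv (coord^~ ('D_xi (ttrans l) p)) e) =
  eval (coord^~ p) (symderiv (coord^~ xi) e').
Proof.
move=> p0 de de' near_e.
have nt : \forall p' \near p, ttrans l p' = ttr p'.
  by apply: filterS (near_coord_neq0 p0) => p'; exact: ttransE.
rewrite (near_eq_derive _ nt).
have dt := differentiable_ttr p0.
have df := differentiable_func (@is_diff_coord R) de.
have dc : 'D_xi (func coord e \o ttr) p =
    'd (func coord e) (ttr p) ('d ttr p xi).
  apply: (etrans (deriveE xi (differentiable_comp dt df))).
  exact: (congr1 (@^~ xi) (diff_comp dt df)).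
transitivity ('D_xi (func coord e \o ttr) p).
  rewrite dc -(deriveE xi dt) -(deriveE _ df).
  exact: (esym (derive_func (@is_diff_coord R) _ de)).
by rewrite (near_eq_derive _ near_e) (derive_func (@is_diff_coord R) _ de').
Qed.

Lemma dotp_trans q : q != 0 -> dotp (trans l q) (trans l q) = (l - eucl q) ^+ 2.
Proof.
rewrite -eucl_eq0 => r0.
transitivity (((l - eucl q) / eucl q) ^+ 2 * dotp q q).
  by rewrite /trans /dotp !mxE; ring.
by rewrite dotpp; field.
Qed.

(** The symmetry gamma(l - r) = gamma(r), written through H. *)
Lemma Hf_trans q : q != 0 ->
  (l - eucl q) ^+ 3 * Hf 0 (dotp (trans l q) (trans l q)) =
  eucl q * stretch q - (l - eucl q).
Proof.
move=> q0; rewrite dotp_trans // -gamma0_eucl -[in RHS]gamma0_reflect gamma0E.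
ring.
Qed.

(** As cos (pi - x) = - cos x, Gamma(l - r) = 2 - Gamma(r). *)
Lemma Bf_trans q : q != 0 ->
  (l - eucl q) ^+ 2 * Bf 0 (dotp (trans l q) (trans l q)) =
  2 - dotp q q * Bf 0 (dotp q q).
Proof.
move=> q0; rewrite dotp_trans // Bf_primitive dotpp Bf_primitive.
have -> : 2 / 3 * (l - eucl q) = - (2 / 3 * eucl q) + pi.
  by rewrite /ell; field.
by rewrite cosDpi cosN; ring.
Qed.

Lemma derive_transE q v : q != 0 -> 'D_v (trans l) q =
  ((l - eucl q) / eucl q) *: v - (l / eucl q ^+ 3 * dotp q v) *: q.
Proof.
move=> q0; have r0 : eucl q != 0 by rewrite eucl_eq0.
rewrite derive_trans //; apply: planeP;
  by rewrite !mxE /= -/(dotp q q) -/(eucl q) /dotp; field.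
Qed.

Lemma decompose q v : q != 0 ->
  v 0 0 = (dotp q v * q 0 0 - cross q v * q 0 1) / eucl q ^+ 2 /\
  v 0 1 = (dotp q v * q 0 1 + cross q v * q 0 0) / eucl q ^+ 2.
Proof.
rewrite -dotp_neq0 -dotpp => s0.
by split; apply: (mulIf s0); rewrite divfK // /dotp /cross; ring.
Qed.

(* The change of charts reverses d/dt and preserves d/dtheta, so that it acts on
   w as a reflection. *)
Lemma rt_trans q v : q != 0 ->
  rt1 (trans l q) ('D_v (trans l) q) =
    rt1 q v - 2 * ((q 0 0 * rt1 q v + q 0 1 * rt2 q v) / eucl q ^+ 2) * q 0 0 /\
  rt2 (trans l q) ('D_v (trans l) q) =
    rt2 q v - 2 * ((q 0 0 * rt1 q v + q 0 1 * rt2 q v) / eucl q ^+ 2) * q 0 1.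
Proof.
move=> q0; have r0 : eucl q != 0 by rewrite eucl_eq0.
have -> : q 0 0 * rt1 q v + q 0 1 * rt2 q v = dotp q v.
  by rewrite /rt1 /rt2 /dotp; ring.
have hf := Hf_trans q0; rewrite /stretch (dotpp q) in hf.
have cr : cross (trans l q) ('D_v (trans l) q) =
    ((l - eucl q) / eucl q) ^+ 2 * cross q v.
  by rewrite derive_transE // /trans /cross !mxE; ring.
rewrite /rt1 /rt2 cr; move: hf.
move: (Hf 0 (dotp (trans l q) _)) => h'.
rewrite (dotpp q); move: (Hf 0 _) => h hf.
rewrite derive_transE // /trans !mxE.
have [-> ->] := decompose v q0.
have e : h' * ((l - eucl q) ^+ 3) = eucl q + eucl q ^+ 3 * h - (l - eucl q).
  by rewrite mulrC hf; ring.
move: (dotp q v) (cross q v) => A X.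
split.
  transitivity ((l - eucl q) / eucl q * ((A * q 0 0 - X * q 0 1) / eucl q ^+ 2)
     - l / eucl q ^+ 3 * A * q 0 0
     - (h' * (l - eucl q) ^+ 3) / eucl q ^+ 3 * X * q 0 1).
    by field.
  by rewrite e; field.
transitivity ((l - eucl q) / eucl q * ((A * q 0 1 + X * q 0 0) / eucl q ^+ 2)
   - l / eucl q ^+ 3 * A * q 0 1
   + (h' * (l - eucl q) ^+ 3) / eucl q ^+ 3 * X * q 0 0).
  by field.
by rewrite e; field.
Qed.

(** The reflection of [rt_trans] on a whole neighbourhood, as needed to differentiate it. *)
Lemma near_refl p : p.1 != 0 -> \forall p' \near p,
  func coord (w1 R) (ttr p') = func coord (reflE 0 (w1 R)) p' /\
  func coord (w2 R) (ttr p') = func coord (reflE 1 (w2 R)) p'.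
Proof.
move=> /near_coord_neq0; apply: filterS => p' p0.
rewrite -ttransE // /func !eval_w1 !eval_w2.
rewrite [(ttrans l p').1]/= [(ttrans l p').2]/=.
have [-> ->] := rt_trans p'.2 p0.
rewrite -!eval_w1 -!eval_w2 /reflE; move: (w1 R) (w2 R) => e1 e2 /=.
rewrite -/(dotp p'.1 p'.1) -/(eucl p'.1).
have r0 : eucl p'.1 != 0 by rewrite eucl_eq0.
by split; field.
Qed.

Lemma defined_refl p j e : p.1 != 0 -> defined (coord^~ p) e ->
  defined (coord^~ p) (reflE j e).
Proof.
by move=> /dotp_gt0; rewrite /dotp /=; have := @derivatives_Hf R; tauto.
Qed.

Lemma dw_ttrans p xi : p.1 != 0 ->
  dw1 (ttrans l p) ('D_xi (ttrans l) p) =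
    eval (coord^~ p) (symderiv (coord^~ xi) (reflE 0 (w1 R))) /\
  dw2 (ttrans l p) ('D_xi (ttrans l) p) =
    eval (coord^~ p) (symderiv (coord^~ xi) (reflE 1 (w2 R))).
Proof.
move=> p0; have d1 x := defined_w1 x : defined x (w1 R).
have d2 x := defined_w2 x : defined x (w2 R).
have n := near_refl p0.
rewrite /dw1 /dw2 ttransE //; split; apply: symderiv_ttr => //.
- exact: defined_refl.
- by apply: filterS n => p' [].
- exact: defined_refl.
- by apply: filterS n => p' [].
Qed.

Lemma coord_ttr p : [/\ coord 0 (ttr p) = func coord (trE 0) p
  & coord 1 (ttr p) = func coord (trE 1) p].
Proof. by split; rewrite /= !mxE /= !(mulr1, mulr0, addr0, add0r). Qed.

(** The projection intertwines [ttrans] and [trans], hence their derivatives. *)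
Lemma ttrans_base p xi : p.1 != 0 ->
  ('D_xi (ttrans l) p).1 = 'D_xi.1 (trans l) p.1.
Proof.
move=> p0; have d j := @defined_ttr p j p0.
have n0 : \forall p' \near p,
    func coord (Var 0) (ttr p') = func coord (trE 0) p'.
  by apply: filterE => p'; have [] := coord_ttr p'.
have n1 : \forall p' \near p,
    func coord (Var 1) (ttr p') = func coord (trE 1) p'.
  by apply: filterE => p'; have [] := coord_ttr p'.
have E0 := symderiv_ttr (e := Var 0) xi p0 I (proj1 (d 0%N)) n0.
have E1 := symderiv_ttr (e := Var 1) xi p0 I (proj1 (d 1%N)) n1.
rewrite derive_trans //; apply: planeP; rewrite !mxE /=.
  by move: E0 => /= ->; move: (Num.sqrt _)^-1 => r; field.
by move: E1 => /= ->; move: (Num.sqrt _)^-1 => r; field.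
Qed.

(** A reflection is an isometry, so lambda is preserved. Its axis turns with theta, so w x dw
    becomes 2 |w|^2 dtheta - w x dw, while Gamma becomes 2 - Gamma and dtheta is preserved. *)
Lemma glue_form p xi : level l (@gamma0 R) 1 false p -> p.1 != 0 ->
  form false p xi = form true (ttrans l p) ('D_xi (ttrans l) p).
Proof.
move=> lp p0; have [_ w] := level_rt lp.
have r0 : eucl p.1 != 0 by rewrite eucl_eq0.
have s0 : dotp p.1 p.1 != 0 by rewrite dotp_neq0.
rewrite !formP ttrans_base //; have [-> ->] := dw_ttrans xi p0.
rewrite [(ttrans l p).1]/= [(ttrans l p).2]/=.
have [-> ->] := rt_trans p.2 p0; have [-> ->] := rt_trans xi.1 p0.
have cr : cross (trans l p.1) ('D_(xi.1) (trans l) p.1) =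
    ((l - eucl p.1) ^+ 2 / dotp p.1 p.1) * cross p.1 xi.1.
  by rewrite derive_transE // /trans /cross !mxE dotpp; field.
have bt : Bf 0 (dotp (trans l p.1) (trans l p.1))
      * cross (trans l p.1) ('D_(xi.1) (trans l) p.1) =
    (2 - dotp p.1 p.1 * Bf 0 (dotp p.1 p.1)) / dotp p.1 p.1 * cross p.1 xi.1.
  by rewrite cr -Bf_trans //; ring.
rewrite bt; pose qw := p.1 0 0 * rt1 p.1 p.2 + p.1 0 1 * rt2 p.1 p.2.
pose dqw := xi.1 0 0 * rt1 p.1 p.2 + p.1 0 0 * dw1 p xi
  + (xi.1 0 1 * rt2 p.1 p.2 + p.1 0 1 * dw2 p xi).
(* Product rule for w - 2 (q . w) q / |q|^2; [qw] is q . w and [dqw] its differential. *)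
have refl_d j e : eval (coord^~ p) (symderiv (coord^~ xi) (reflE j e)) =
    eval (coord^~ p) (symderiv (coord^~ xi) e)
    - 2 / dotp p.1 p.1 * (dqw * coord j p + qw * coord j xi)
    + 4 / dotp p.1 p.1 ^+ 2 * dotp p.1 xi.1 * qw * coord j p.
  rewrite /qw /dqw.
  rewrite -eval_w1 -eval_w2 /reflE /dw1 /dw2; move: (w1 R) (w2 R) => e1 e2 /=.
  rewrite -/(dotp p.1 p.1) -/(eucl p.1) dotpp.
  move: (coord j _) (coord j _) => c c'.
  by rewrite /dotp; field.
rewrite !refl_d -/(dw1 p xi) -/(dw2 p xi) -dotpp /= /qw /dqw.
move: w; move: (rt1 p.1 p.2) (rt2 p.1 p.2) (rt1 p.1 xi.1) (rt2 p.1 xi.1).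
move=> a b c d.
move: (dw1 p xi) (dw2 p xi) (Bf _ _) => d1 d2 B w.
move: s0; rewrite /dotp /cross.
move: (p.1 0 0) (p.1 0 1) (xi.1 0 0) (xi.1 0 1) => x1 x2 u1 u2 s0.
apply/eqP; rewrite -subr_eq0; apply/eqP; set D := (X in X = 0).
(* The discrepancy is 2 (|w|^2 - 1) dtheta, which vanishes on the level. *)
have -> : D = 2 * (a ^+ 2 + b ^+ 2 - 1) * (x1 * u2 - x2 * u1)
    / (x1 * x1 + x2 * x2).
  by rewrite /D expr0 expr1; field.
by rewrite w subrr mulr0 !mul0r.
Qed.

End gluing.

Theorem proposition5p11 (R : realType) :
  exists (l : R) (gamma : R -> R) (m : R),
    [/\ normalised_profile l gamma,
        0 < m,
        contact_type l gamma m
      & ~ (forall t : R, 0 <= t <= l -> 0 < magnetic_curvature l gamma m t)].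
Proof.
exists (ell R), (@gamma0 R), 1; split.
- exact: normalised_gamma0.
- exact: ltr01.
- exists (@form R); split; [|exact: primitive_form|exact: contact_form].
  split=> [i|p xi lp p0 _]; last exact: glue_form.
  by exists setT; split=> //; [exact: openT|exact: smooth_form].
- exact: curvature_mid.
Qed.
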